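(* Let $n\ge 1$. Let $\mathbb{C}B_n^-$ be the spin Weyl group superalgebra of type $B_n$ with odd generators $t_1,\dots,t_n$, and let $\mathcal{C}l_n$ be the Clifford superalgebra with odd generators $c_1,\dots,c_n$. Put $\beta_i=\frac{1}{\sqrt2}(c_i-c_{i+1})$ for $1\le i\le n-1$. Let $\mathcal{C}l_n\otimes\mathbb{C}S_n$ be the tensor product superalgebra in which the group algebra $\mathbb{C}S_n$ is purely even (so each simple transposition $s_i=(i,i+1)$ is even and commutes with every $c_j$). Then there is an isomorphism of superalgebras $$\phi^B:\ \mathbb{C}B_n^-\ \xrightarrow{\ \cong\ }\ \mathcal{C}l_n\otimes\mathbb{C}S_n,\qquad t_i\mapsto\begin{cases}\beta_i s_i, & 1\le i\le n-1,\\ c_n, & i=n.\end{cases}$$ The inverse map sends $c_i\mapsto(-1)^{n-i}\,t_it_{i+1}\cdots t_{n-1}t_nt_{n-1}\cdots t_{i+1}t_i$ for $1\le i\le n$ and $s_i\mapsto\beta_it_i$ for $1\le i\le n-1$ (where $\beta_i$ is expressed through the images of $c_i,c_{i+1}$).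
   Context: All algebras are over $\mathbb{C}$. A superalgebra is a $\mathbb{Z}_2$-graded associative unital algebra. $\mathbb{C}B_n^-$ is the algebra generated by $t_1,\dots,t_n$ with relations $t_i^2=1$ for all $i$; $t_it_{i+1}t_i=t_{i+1}t_it_{i+1}$ for $1\le i\le n-2$; $(t_it_j)^2=-1$ for $1\le i,j\le n$ with $|i-j|>1$; and $(t_{n-1}t_n)^4=-1$. It is a superalgebra with every $t_i$ odd. $\mathcal{C}l_n$ is generated by odd elements $c_1,\dots,c_n$ with $c_i^2=1$ and $c_ic_j=-c_jc_i$ for $i\ne j$. *)

(* Defs.v *)
From HB Require Import structures.
From mathcomp Require Import all_fingroup.
From mathcomp Require Import all_boot all_order all_algebra.
From mathcomp Require Import finmap.
From mathcomp Require Import boolp reals.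
From mathcomp.multinomials Require Import monalg.
From mathcomp.real_closed Require Import complex.

Set Implicit Arguments.
Unset Strict Implicit.
Unset Printing Implicit Defensive.

Import GRing.Theory.
Local Open Scope quotient_scope.
Local Open Scope ring_scope.

(* Parities are booleans: false is even, true is odd, (+) is their sum.
   MathComp's algType requires 1 != 0, which is not known a priori for an algebra
   given by generators and relations, and Hierarchy Builder does not allow
   a structure joining pzRingType and lmodType below it. The multiplication is
   therefore part of this mixin, and the pzRingType structure is derived. *)
HB.mixin Record Lmodule_isSuperalgebra (K : comNzRingType) A
    of GRing.Lmodule K A := {
  saone : A;
  samul : A -> A -> A;
  samulA : associative samul;
  samul1l : left_id saone samul;
  samul1r : right_id saone samul;
  samulDl : left_distributive samul +%R;
  samulDr : right_distributive samul +%R;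
  sascalerAl : forall (k : K) x y, k *: samul x y = samul (k *: x) y;
  sascalerAr : forall (k : K) x y, k *: samul x y = samul x (k *: y);
  homog : bool -> A -> Prop;
  homog0 : forall b, homog b 0;
  homogP : forall b (k : K) x y, homog b x -> homog b y -> homog b (k *: x + y);
  homog_split : forall x, exists y z,
    [/\ homog false y, homog true z & x = y + z];
  homog_indep : forall x, homog false x -> homog true x -> x = 0;
  sahomogM : forall b c x y,
    homog b x -> homog c y -> homog (b (+) c) (samul x y)
}.

#[short(type="superAlgType")]
HB.structure Definition Superalgebra (K : comNzRingType) :=
  {A of GRing.Lmodule K A & Lmodule_isSuperalgebra K A}.

HB.instance Definition _ (K : comNzRingType) (A : superAlgType K) :=
  GRing.Zmodule_isPzRing.Build (Superalgebra.sort A)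
    samulA samul1l samul1r samulDl samulDr.

HB.factory Record PzRing_isSuperalgebra (K : comNzRingType) A
    of GRing.PzRing A & GRing.Lmodule K A := {
  pscalerAl : forall (k : K) (x y : A), k *: (x * y) = (k *: x) * y;
  pscalerAr : forall (k : K) (x y : A), k *: (x * y) = x * (k *: y);
  phomog : bool -> A -> Prop;
  phomog0 : forall b, phomog b 0;
  phomogP : forall b (k : K) x y,
    phomog b x -> phomog b y -> phomog b (k *: x + y);
  phomog_split : forall x, exists y z,
    [/\ phomog false y, phomog true z & x = y + z];
  phomog_indep : forall x, phomog false x -> phomog true x -> x = 0;
  phomogM : forall b c x y,
    phomog b x -> phomog c y -> phomog (b (+) c) (x * y)
}.

HB.builders Context K A of PzRing_isSuperalgebra K A.
HB.instance Definition _ := Lmodule_isSuperalgebra.Build K A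
  (@mulrA A) (@mul1r A) (@mulr1 A) (@mulrDl A) (@mulrDr A) pscalerAl pscalerAr
  phomog0 phomogP phomog_split phomog_indep phomogM.
HB.end.

Definition superalg_morphism (K : comNzRingType) (A B : superAlgType K)
    (f : A -> B) :=
  [/\ linear f, f 1 = 1, {morph f : x y / x * y}
    & forall b x, homog b x -> homog b (f x)].

Section SuperalgTheory.
Variables (K : comNzRingType) (A : superAlgType K).
Implicit Types (b c : bool) (x y : A) (k : K).

Lemma homogM b c x y : homog b x -> homog c y -> homog (b (+) c) (x * y).
Proof. exact: sahomogM. Qed.

Lemma sscalerAl k x y : k *: (x * y) = (k *: x) * y.
Proof. exact: sascalerAl. Qed.

Lemma sscalerAr k x y : k *: (x * y) = x * (k *: y).
Proof. exact: sascalerAr. Qed.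

Lemma homogZ b k x : homog b x -> homog b (k *: x).
Proof. by move=> hx; rewrite -[_ *: _]addr0; apply: homogP => //; apply: homog0. Qed.

Lemma homogD b x y : homog b x -> homog b y -> homog b (x + y).
Proof. by move=> hx hy; rewrite -[x]scale1r; apply: homogP. Qed.

Lemma homogN b x : homog b x -> homog b (- x).
Proof. by move=> hx; rewrite -scaleN1r; apply: homogZ. Qed.

Lemma homogB b x y : homog b x -> homog b y -> homog b (x - y).
Proof. by move=> hx hy; apply: homogD => //; apply: homogN. Qed.

Lemma homog_disj b x : homog b x -> homog (~~ b) x -> x = 0.
Proof. by case: b => ? ?; apply: homog_indep. Qed.

Lemma hproj_ex b x : exists y, homog b y /\ homog (~~ b) (x - y).
Proof.
have [y [z [hy hz ->]]] := homog_split x.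
case: b; [exists z | exists y]; first by rewrite addrK.
by rewrite addrC addKr.
Qed.

Definition hproj b x : A := sval (cid (hproj_ex b x)).

Lemma hproj_homog b x : homog b (hproj b x).
Proof. by rewrite /hproj; case: cid => y []. Qed.

Lemma hproj_compl b x : homog (~~ b) (x - hproj b x).
Proof. by rewrite /hproj; case: cid => y []. Qed.

Lemma hproj_uniq b x y : homog b y -> homog (~~ b) (x - y) -> hproj b x = y.
Proof.
move=> hy hxy; apply/eqP; rewrite -subr_eq0; apply/eqP.
apply: (@homog_disj b); first by apply: homogB => //; apply: hproj_homog.
have -> : hproj b x - y = (x - y) - (x - hproj b x).
  by rewrite opprB [RHS]addrC addrA subrK.
by apply: homogB => //; apply: hproj_compl.
Qed.

Lemma hproj_linear b : linear (hproj b).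
Proof.
move=> k x y; apply: hproj_uniq.
  by apply: homogP; apply: hproj_homog.
have -> : k *: x + y - (k *: hproj b x + hproj b y)
        = k *: (x - hproj b x) + (y - hproj b y).
  by rewrite scalerBr opprD addrACA.
by apply: homogP; apply: hproj_compl.
Qed.

HB.instance Definition _ b := GRing.isLinear.Build K A A *:%R (hproj b)
  (hproj_linear b).

Lemma hproj_id b x : homog b x -> hproj b x = x.
Proof. by move=> hx; apply: hproj_uniq => //; rewrite subrr; apply: homog0. Qed.

Lemma hproj_eq0 b x : homog (~~ b) x -> hproj b x = 0.
Proof. by move=> hx; apply: hproj_uniq; rewrite ?subr0 //; apply: homog0. Qed.

Lemma hproj_if b c x : homog c x -> hproj b x = if b == c then x else 0.
Proof.
case: eqP => [->|bc] hx; first exact: hproj_id.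
by apply: hproj_eq0; move: hx bc; case: b; case: c.
Qed.

Lemma hproj_sum x : x = hproj false x + hproj true x.
Proof.
have [y [z [hy hz ->]]] := homog_split x.
by rewrite !linearD /= !(hproj_if _ hy) !(hproj_if _ hz) /= addr0 add0r.
Qed.

Lemma homog1 : homog false (1 : A).
Proof.
suff h0 : hproj true (1 : A) = 0.
  by rewrite [1]hproj_sum h0 addr0; apply: hproj_homog.
have key b x : homog b x -> x * hproj true 1 = 0.
  move=> hx; apply: (@homog_disj b).
    have -> : x * hproj true 1 = x - x * hproj false 1.
      by rewrite -{2}[x]mulr1 [X in x * X - _]hproj_sum mulrDr addrC addKr.
    apply: homogB => //; rewrite -[b]addbF.
    by apply: homogM => //; apply: hproj_homog.
  rewrite -addbT; apply: homogM => //; exact: hproj_homog.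
rewrite -[LHS]mul1r [X in X * _]hproj_sum mulrDl.
by rewrite !(key _ _ (hproj_homog _ _)) addr0.
Qed.

Lemma homog_hprojP b x : homog b x <-> hproj b x = x.
Proof. by split=> [/hproj_id //|<-]; apply: hproj_homog. Qed.

Lemma hprojM b x y :
  hproj b (x * y) =
  hproj false x * hproj b y + hproj true x * hproj (~~ b) y.
Proof.
rewrite {1}[x]hproj_sum {1}[y]hproj_sum mulrDl !mulrDr !linearD /=.
have h p q := hproj_if b (homogM (hproj_homog p x) (hproj_homog q y)).
by rewrite !h; case: b {h}; rewrite /= ?addr0 ?add0r // addrC.
Qed.

End SuperalgTheory.

(* The constants below are locked: unfolding them during unification is costly. *)
Fact salg_key : unit. Proof. exact: tt. Qed.

Section Quotient.
Variables (K : comNzRingType) (V : lmodType K).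

Inductive span (S : V -> Prop) : V -> Prop :=
| span0 : span S 0
| spanC k v w : S v -> span S w -> span S (k *: v + w).

Section SpanTheory.
Variable S : V -> Prop.

Lemma span_mem v : S v -> span S v.
Proof.
by move=> Sv; rewrite -[v]addr0 -[v]scale1r; apply: spanC => //; apply: span0.
Qed.

Lemma spanD v w : span S v -> span S w -> span S (v + w).
Proof.
move=> Sv Sw; elim: Sv => [|k u v' Su _ IH]; first by rewrite add0r.
by rewrite -addrA; apply: spanC.
Qed.

Lemma spanZ k v : span S v -> span S (k *: v).
Proof.
elim=> [|l u w Su _ IH]; first by rewrite scaler0; apply: span0.
by rewrite scalerDr scalerA; apply: spanC.
Qed.

Lemma spanN v : span S v -> span S (- v).
Proof. by rewrite -scaleN1r; apply: spanZ. Qed.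

Lemma spanB v w : span S v -> span S w -> span S (v - w).
Proof. by move=> Sv Sw; apply: spanD => //; apply: spanN. Qed.

Definition qeq : rel V := fun v w => `[< span S (v - w) >].

Lemma qeq_refl : reflexive qeq.
Proof. by move=> v; apply/asboolP; rewrite subrr; apply: span0. Qed.

Lemma qeq_sym : symmetric qeq.
Proof.
move=> v w; apply/asboolP/asboolP; by move/spanN; rewrite opprB.
Qed.

Lemma qeq_trans : transitive qeq.
Proof.
move=> v u w /asboolP h1 /asboolP h2; apply/asboolP.
by rewrite -[u](subrK v) -addrA; apply: spanD.
Qed.

Canonical qeq_equiv := EquivRel qeq qeq_refl qeq_sym qeq_trans.

Definition quot := {eq_quot qeq_equiv}.
HB.instance Definition _ := Choice.on quot.
HB.instance Definition _ := EqQuotient.on quot.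

Definition qpi_def (v : V) : quot := \pi_quot v.
Definition qpi := locked_with salg_key qpi_def.
Canonical qpi_unlockable := [unlockable fun qpi].

Lemma qpiP v w : qpi v = qpi w <-> span S (v - w).
Proof.
rewrite unlock; split=> [/eqmodP/asboolP //|h]; apply/eqmodP; exact/asboolP.
Qed.

Lemma qpi_repr (x : quot) : qpi (repr x) = x.
Proof. by rewrite unlock; exact: reprK. Qed.

Lemma qrepr_pi v : span S (repr (qpi v) - v).
Proof. by apply/qpiP; rewrite qpi_repr. Qed.

Definition qzero : quot := qpi 0.
Definition qadd (x y : quot) : quot := qpi (repr x + repr y).
Definition qopp (x : quot) : quot := qpi (- repr x).
Definition qscale k (x : quot) : quot := qpi (k *: repr x).

Lemma qaddE v w : qadd (qpi v) (qpi w) = qpi (v + w).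
Proof.
by apply/qpiP; rewrite opprD addrACA; apply: spanD; apply: qrepr_pi.
Qed.

Lemma qoppE v : qopp (qpi v) = qpi (- v).
Proof.
by apply/qpiP; rewrite -opprD; apply: spanN; apply: qrepr_pi.
Qed.

Lemma qscaleE k v : qscale k (qpi v) = qpi (k *: v).
Proof.
by apply/qpiP; rewrite -scalerBr; apply: spanZ; apply: qrepr_pi.
Qed.

Lemma quotW (P : quot -> Prop) : (forall v, P (qpi v)) -> forall x, P x.
Proof. by move=> h x; rewrite -[x]qpi_repr. Qed.

Lemma qaddA : associative qadd.
Proof.
by elim/quotW=> u; elim/quotW=> v; elim/quotW=> w; rewrite !qaddE addrA.
Qed.

Lemma qaddC : commutative qadd.
Proof. by elim/quotW=> u; elim/quotW=> v; rewrite !qaddE addrC. Qed.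

Lemma qadd0 : left_id qzero qadd.
Proof. by elim/quotW=> u; rewrite qaddE add0r. Qed.

Lemma qaddN : left_inverse qzero qopp qadd.
Proof. by elim/quotW=> u; rewrite qoppE qaddE addNr. Qed.

HB.instance Definition _ := GRing.isZmodule.Build quot
  qaddA qaddC qadd0 qaddN.

Lemma qscaleA k l (x : quot) : qscale k (qscale l x) = qscale (k * l) x.
Proof. by elim/quotW: x => u; rewrite !qscaleE scalerA. Qed.

Lemma qscale1 : left_id 1 qscale.
Proof. by elim/quotW=> u; rewrite !qscaleE scale1r. Qed.

Lemma qscaleDr : right_distributive qscale +%R.
Proof.
move=> k; elim/quotW=> u; elim/quotW=> v.
by rewrite [_ + _]qaddE !qscaleE [RHS]qaddE scalerDr.
Qed.

Lemma qscaleDl (x : quot) : {morph qscale^~ x : k l / k + l}.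
Proof.
by move=> k l; elim/quotW: x => u; rewrite !qscaleE [RHS]qaddE scalerDl.
Qed.

HB.instance Definition _ := GRing.Zmodule_isLmodule.Build K quot
  qscaleA qscale1 qscaleDr qscaleDl.

Lemma qpi_linear : linear qpi.
Proof. by move=> k u v; rewrite [k *: qpi u]qscaleE [RHS]qaddE. Qed.

HB.instance Definition _ := GRing.isLinear.Build K V quot *:%R qpi qpi_linear.

Lemma qpi_eq0 v : qpi v = 0 <-> span S v.
Proof. by rewrite -[v in span S v]subr0; apply: qpiP. Qed.

Definition qlift (W : Type) (f : V -> W) (x : quot) : W := f (repr x).

Lemma span_lin (W : lmodType K) (f : V -> W) (T : W -> Prop) :
    linear f -> T 0 -> (forall u v, T u -> T v -> T (u + v)) ->
    (forall k u, T u -> T (k *: u)) ->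
  (forall v, S v -> T (f v)) -> forall v, span S v -> T (f v).
Proof.
move=> fl T0 TD TZ ST v; elim=> [|k u w Su _ IH].
  have -> : f 0 = 0 by rewrite -[0]addr0 -[X in f (X + _)](scaler0 _ (-1))
    fl scaleN1r addNr.
  by [].
by rewrite fl; apply: TD => //; apply/TZ/ST.
Qed.

Lemma qliftE (W : lmodType K) (f : V -> W) : linear f ->
  (forall v, S v -> f v = 0) -> forall v, qlift f (qpi v) = f v.
Proof.
move=> fl fS v; apply/eqP; rewrite -subr_eq0; apply/eqP.
have -> : qlift f (qpi v) - f v = f (repr (qpi v) - v).
  by rewrite addrC -[in RHS]scaleN1r [in RHS]addrC fl scaleN1r.
apply: (@span_lin _ _ (fun w => w = 0) fl) (qrepr_pi v) => //.
  by move=> ? ? -> ->; rewrite addr0.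
by move=> ? ? ->; rewrite scaler0.
Qed.

Lemma qlift_linear (W : lmodType K) (f : V -> W) : linear f ->
  (forall v, S v -> f v = 0) -> linear (qlift f).
Proof.
move=> fl fS k; elim/quotW=> u; elim/quotW=> v.
by rewrite -linearP /= !qliftE // fl.
Qed.

End SpanTheory.
End Quotient.

(* Relations l = r whose two sides are homogeneous of the same parity. *)
Record hrelations (K : comNzRingType) (A : superAlgType K) := HRelations {
  hrel :> A -> A -> Prop;
  hrelP : forall l r, hrel l r -> exists b, homog b l /\ homog b r
}.

Section Squot.
Variables (K : comNzRingType) (A : superAlgType K) (E : hrelations A).

Variant ideal_gen : A -> Prop :=
  IdealGen u v l r of E l r : ideal_gen (u * (l - r) * v).

Definition squot := quot ideal_gen.
HB.instance Definition _ := GRing.Lmodule.on squot.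

Definition spi (x : A) : squot := qpi ideal_gen x.
HB.instance Definition _ := GRing.isLinear.Build K A squot *:%R spi
  (qpi_linear ideal_gen).

Lemma ideal_mull u x : span ideal_gen x -> span ideal_gen (u * x).
Proof.
elim=> [|k v w [a b l r Elr] _ IH]; first by rewrite mulr0; apply: span0.
rewrite mulrDr -sscalerAr !mulrA; apply: spanC => //.
Qed.

Lemma ideal_mulr u x : span ideal_gen x -> span ideal_gen (x * u).
Proof.
elim=> [|k v w [a b l r Elr] _ IH]; first by rewrite mul0r; apply: span0.
rewrite mulrDl -sscalerAl -mulrA; apply: spanC => //.
Qed.

Definition sqmul_def (x y : squot) : squot := spi (repr x * repr y).
Definition sqmul := locked_with salg_key sqmul_def.
Canonical sqmul_unlockable := [unlockable fun sqmul].

Lemma sqmulE x y : sqmul (spi x) (spi y) = spi (x * y).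
Proof.
rewrite unlock; apply/qpiP; rewrite -[X in X - _](subrK (repr (spi x) * y)) -mulrBr -addrA -mulrBl.
apply: spanD; first by apply: ideal_mull; apply: qrepr_pi.
by apply: ideal_mulr; apply: qrepr_pi.
Qed.

Lemma squotW (P : squot -> Prop) : (forall v, P (spi v)) -> forall x, P x.
Proof. exact: quotW. Qed.

Lemma sqmulA : associative sqmul.
Proof.
by elim/squotW=> u; elim/squotW=> v; elim/squotW=> w; rewrite !sqmulE mulrA.
Qed.

Lemma sqmul1l : left_id (spi 1) sqmul.
Proof. by elim/squotW=> u; rewrite !sqmulE mul1r. Qed.

Lemma sqmul1r : right_id (spi 1) sqmul.
Proof. by elim/squotW=> u; rewrite !sqmulE mulr1. Qed.

Lemma sqmulDl : left_distributive sqmul +%R.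
Proof.
elim/squotW=> u; elim/squotW=> v; elim/squotW=> w.
by rewrite -linearD !sqmulE -linearD /= mulrDl.
Qed.

Lemma sqmulDr : right_distributive sqmul +%R.
Proof.
elim/squotW=> u; elim/squotW=> v; elim/squotW=> w.
by rewrite -linearD !sqmulE -linearD /= mulrDr.
Qed.

HB.instance Definition _ := GRing.Zmodule_isPzRing.Build squot
  sqmulA sqmul1l sqmul1r sqmulDl sqmulDr.

Lemma spiM : {morph spi : x y / x * y}.
Proof. by move=> x y; rewrite [RHS]sqmulE. Qed.

Lemma spiZ k x : spi (k *: x) = k *: spi x.
Proof. by rewrite linearZ. Qed.

Lemma spi1 : spi 1 = 1.
Proof. by []. Qed.

Lemma sq_scalerAl k (x y : squot) : k *: (x * y) = (k *: x) * y.
Proof.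
elim/squotW: x => u; elim/squotW: y => v.
by rewrite -spiM -!spiZ -spiM sscalerAl.
Qed.

Lemma sq_scalerAr k (x y : squot) : k *: (x * y) = x * (k *: y).
Proof.
elim/squotW: x => u; elim/squotW: y => v.
by rewrite -spiM -!spiZ -spiM sscalerAr.
Qed.

Definition sq_homog b (x : squot) := exists2 u : A, homog b u & x = spi u.

Lemma ideal_hproj b x : span ideal_gen x -> span ideal_gen (hproj b x).
Proof.
elim=> [|k _ w [u v l r Elr] _ IH]; first by rewrite linear0; apply: span0.
rewrite linearP /=; apply: spanD => //; apply: spanZ.
have [c [hl hr]] := hrelP Elr; have hlr := homogB hl hr.
have lin p q : span ideal_gen (hproj p u * (l - r) * hproj q v).
  by apply: span_mem; apply: IdealGen.
have hu p : exists q, hproj p (u * (l - r)) = hproj q u * (l - r).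
  rewrite hprojM !(hproj_if _ hlr).
  case: (p =P c) => [->|pc].
    by exists false; rewrite (_ : (~~ c == c) = false) ?mulr0 ?addr0 //; case: (c).
  exists true; rewrite (_ : (~~ p == c)) ?mulr0 ?add0r //.
  by move: pc; case: (p); case: (c).
rewrite hprojM; have [q ->] := hu false; have [q' ->] := hu true.
by apply: spanD.
Qed.

Lemma sq_homog0 b : sq_homog b 0.
Proof. by exists 0; [apply: homog0 | rewrite linear0]. Qed.

Lemma sq_homogP b (k : K) x y :
  sq_homog b x -> sq_homog b y -> sq_homog b (k *: x + y).
Proof.
move=> [u hu ->] [v hv ->]; exists (k *: u + v); first exact: homogP.
by rewrite linearP.
Qed.

Lemma sq_homog_split x : exists y z,
  [/\ sq_homog false y, sq_homog true z & x = y + z].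
Proof.
elim/squotW: x => u; exists (spi (hproj false u)), (spi (hproj true u)).
split; [by exists (hproj false u); [apply: hproj_homog|] |
        by exists (hproj true u); [apply: hproj_homog|] |].
by rewrite -linearD /= -hproj_sum.
Qed.

Lemma sq_homog_indep x : sq_homog false x -> sq_homog true x -> x = 0.
Proof.
move=> [u hu ->] [v hv] /qpiP /(ideal_hproj false).
rewrite linearB /= (hproj_id hu) hproj_eq0 // subr0 => h.
exact/qpi_eq0.
Qed.

Lemma sq_homogM b c x y :
  sq_homog b x -> sq_homog c y -> sq_homog (b (+) c) (x * y).
Proof.
move=> [u hu ->] [v hv ->]; exists (u * v); first exact: homogM.
by rewrite spiM.
Qed.

HB.instance Definition _ := PzRing_isSuperalgebra.Build K squot
  sq_scalerAl sq_scalerAr sq_homog0 sq_homogP sq_homog_split sq_homog_indep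
  sq_homogM.

End Squot.

Section FreeLift.
Variables (K : comNzRingType) (T : choiceType) (W : lmodType K) (h : T -> W).

Definition flift (g : {malg K[T]}) : W := \sum_(t <- msupp g) g@_t *: h t.

Lemma flift_linear : linear flift.
Proof.
have ext (d : {fset T}) g : (msupp g `<=` d)%fset ->
    flift g = \sum_(t <- d) g@_t *: h t.
  move=> le; rewrite [LHS](big_fset_incl _ le) => //= x xd /mcoeff_outdom ->.
  by rewrite scale0r.
move=> k g1 g2; pose d := (msupp (k *: g1 + g2) `|` (msupp g1 `|` msupp g2))%fset.
have s0 : (msupp (k *: g1 + g2) `<=` d)%fset by apply: fsubsetUl.
have s1 : (msupp g1 `<=` d)%fset.
  by apply: fsubsetU; rewrite fsubsetUl orbT.
have s2 : (msupp g2 `<=` d)%fset.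
  by apply: fsubsetU; rewrite fsubsetUr orbT.
rewrite !(ext d) // scaler_sumr -big_split /=; apply: eq_bigr => t _.
by rewrite mcoeffD mcoeffZ scalerDl scalerA.
Qed.

Lemma fliftU t : flift << t >> = h t.
Proof.
rewrite /flift msuppU oner_eq0 big_seq_fset1 mcoeffUU; exact: scale1r.
Qed.

End FreeLift.

Lemma malg_ind (K : comNzRingType) (T : choiceType) (P : {malg K[T]} -> Prop) :
  P 0 -> (forall g1 g2, P g1 -> P g2 -> P (g1 + g2)) ->
  (forall k t, P (k *: << t >>)) -> forall g, P g.
Proof.
move=> P0 PD PU g; rewrite [g]monalgE; elim/big_ind: _ => // t _.
have -> : << g@_t *g t >> = g@_t *: << t >> :> {malg K[T]}.
  by apply/malgP=> s; rewrite mcoeffZ !mcoeffU mulrnAr mulr1.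
exact: PU.
Qed.

Lemma malg_scalerAr (K : comNzRingType) (T : monomType) k (x y : {malg K[T]}) :
  k *: (x * y) = x * (k *: y).
Proof.
apply/malgP=> w; rewrite mcoeffZ.
rewrite (mcoeffMl x y) (mcoeffMlw w (fsubset_refl (msupp x)) (msuppZ_le k y)).
rewrite mulr_sumr; apply: eq_bigr => u _; rewrite mulr_sumr; apply: eq_bigr => v _.
by rewrite mcoeffZ mulrCA mulrnAr.
Qed.

Section FreeSuperalgebra.
Variables (K : comNzRingType) (I : choiceType).

(* The free superalgebra on odd generators indexed by I. *)
Definition freealg := {malg K[{fmonom I}]}.
HB.instance Definition _ := GRing.Lalgebra.on freealg.

Definition fgen_def (i : I) : freealg := << fmu i >>.
Definition fgen := locked_with salg_key fgen_def.
Canonical fgen_unlockable := [unlockable fun fgen].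

Definition fr_homog b (x : freealg) :=
  forall w : {fmonom I}, x@_w != 0 -> odd (fdeg w) = b.

Lemma fr_homog0 b : fr_homog b 0.
Proof. by move=> w; rewrite mcoeff0 eqxx. Qed.

Lemma fr_homogP b (k : K) x y :
  fr_homog b x -> fr_homog b y -> fr_homog b (k *: x + y).
Proof.
move=> hx hy w; rewrite mcoeffD mcoeffZ.
have [x0|/hx //] := eqVneq (x@_w) 0; have [y0|/hy //] := eqVneq (y@_w) 0.
by rewrite x0 y0 mulr0 addr0 eqxx.
Qed.

Lemma fr_homogU k (w : {fmonom I}) : fr_homog (odd (fdeg w)) (k *: << w >>).
Proof.
move=> v; rewrite mcoeffZ mcoeffU1; have [-> //|_] := eqVneq w v.
by rewrite mulr0 eqxx.
Qed.

Lemma fr_homogD b x y : fr_homog b x -> fr_homog b y -> fr_homog b (x + y).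
Proof. by move=> hx hy; rewrite -[x]scale1r; apply: fr_homogP. Qed.

Lemma fr_homog_split x : exists y z,
  [/\ fr_homog false y, fr_homog true z & x = y + z].
Proof.
elim/malg_ind: x => [|x y [x0 [x1 [h0 h1 ->]]] [y0 [y1 [k0 k1 ->]]]|k w].
- by exists 0, 0; rewrite addr0; split=> //; apply: fr_homog0.
- exists (x0 + y0), (x1 + y1); rewrite addrACA; split=> //; exact: fr_homogD.
case ow : (odd (fdeg w)); [exists 0, (k *: << w >>) | exists (k *: << w >>), 0].
  by rewrite add0r -ow; split=> //; [apply: fr_homog0 | apply: fr_homogU].
by rewrite addr0 -{1}ow; split=> //; [apply: fr_homogU | apply: fr_homog0].
Qed.

Lemma fr_homog_indep x : fr_homog false x -> fr_homog true x -> x = 0.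
Proof.
move=> h0 h1; apply/malgP=> w; rewrite mcoeff0; apply/eqP.
by case: eqVneq => // xw; move: (h0 _ xw); rewrite (h1 _ xw).
Qed.

Lemma fr_homogM b c x y :
  fr_homog b x -> fr_homog c y -> fr_homog (b (+) c) (x * y).
Proof.
move=> hx hy w; rewrite mcoeff_neq0 => /msuppM_le [u [v [ux vy ->]]].
by rewrite fdegM oddD (hx u) ?(hy v) ?mcoeff_neq0.
Qed.

HB.instance Definition _ := PzRing_isSuperalgebra.Build K freealg
  (@scalerAl _ _) (@malg_scalerAr K _) fr_homog0 fr_homogP fr_homog_split
  fr_homog_indep fr_homogM.

Lemma homog_fgen i : homog true (fgen i).
Proof.
move=> w; rewrite unlock mcoeffU1; have [<- _|_] := eqVneq (fmu i) w.
  by rewrite fdegU.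
by rewrite eqxx.
Qed.

End FreeSuperalgebra.

Arguments fgen {K I} i.
Arguments homog_fgen {K I} i.

Section Clifford.
Variables (K : comNzRingType) (n : nat).
Implicit Types i j : 'I_n.

Variant cliff_rel : freealg K 'I_n -> freealg K 'I_n -> Prop :=
| CliffSq i : cliff_rel (fgen i ^+ 2) 1
| CliffAnti i j of i != j :
    cliff_rel (fgen i * fgen j) (- (fgen j * fgen i)).

Lemma cliff_relP l r : cliff_rel l r -> exists b, homog b l /\ homog b r.
Proof.
have g1 i := @homog_fgen K _ i; have g2 i j := homogM (g1 i) (g1 j).
case=> [i|i j _]; exists false; split.
- exact: (g2 i i).
- exact: homog1.
- exact: (g2 i j).
- exact: (homogN (g2 j i)).
Qed.

Definition cliff := squot (HRelations cliff_relP).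
HB.instance Definition _ := Superalgebra.on cliff.

Definition cgen i : cliff := spi (HRelations cliff_relP) (fgen i).

Lemma homog_cgen i : homog true (cgen i).
Proof. by exists (fgen i) => //; exact: homog_fgen. Qed.

End Clifford.

Arguments cgen {K n} i.

Section SpinB.
Variables (K : comNzRingType) (n : nat).
Implicit Types i j : 'I_n.

(* The generators t_1, ..., t_n are indexed by 'I_n, with t_i at index i - 1. *)
Variant spinB_rel : freealg K 'I_n -> freealg K 'I_n -> Prop :=
| SpinBSq i : spinB_rel (fgen i ^+ 2) 1
| SpinBBraid i j of j = i.+1 :> nat & (j.+1 < n)%N :
    spinB_rel (fgen i * fgen j * fgen i) (fgen j * fgen i * fgen j)
| SpinBFar i j of (i.+1 < j)%N || (j.+1 < i)%N :
    spinB_rel ((fgen i * fgen j) ^+ 2) (- 1)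
| SpinBLast i j of j = i.+1 :> nat & j.+1 = n :
    spinB_rel ((fgen i * fgen j) ^+ 4) (- 1).

Lemma spinB_relP l r : spinB_rel l r -> exists b, homog b l /\ homog b r.
Proof.
have g1 i := @homog_fgen K _ i; have g2 i j := homogM (g1 i) (g1 j).
have g3 i j k := homogM (g2 i j) (g1 k).
have gX i j k : homog false ((fgen i * fgen j : freealg K 'I_n) ^+ k).
  elim: k => [|k IH]; first exact: homog1.
  by rewrite exprS; apply: (homogM (g2 i j) IH).
have hN1 := homogN (homog1 (freealg K 'I_n)).
case=> [i|i j _ _|i j _|i j _ _].
- by exists false; split; [exact: (g2 i i) | exact: homog1].
- by exists true; split; [exact: (g3 i j i) | exact: (g3 j i j)].
- by exists false; split; [exact: (gX i j 2) | exact: hN1].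
- by exists false; split; [exact: (gX i j 4) | exact: hN1].
Qed.

Definition spinB := squot (HRelations spinB_relP).
HB.instance Definition _ := Superalgebra.on spinB.

Definition tgen i : spinB := spi (HRelations spinB_relP) (fgen i).

Lemma homog_tgen i : homog true (tgen i).
Proof. by exists (fgen i) => //; exact: homog_fgen. Qed.

(* (-1)^(n-i) t_i t_(i+1) ... t_(n-1) t_n t_(n-1) ... t_(i+1) t_i *)
Definition tpalin i : spinB :=
  (-1) ^+ (n - i.+1) *:
  (\prod_(j <- [seq j : 'I_n <- enum 'I_n | (i <= j)%N]) tgen j *
   \prod_(j <- rev [seq j : 'I_n <- enum 'I_n | (i <= j)%N && (j.+1 < n)%N]) tgen j).

End SpinB.

Arguments tgen {K n} i.
Arguments tpalin {K n} i.

Section GroupAlgebra.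
Variables (K : comNzRingType) (gT : finGroupType).

Definition grpalg := {ffun gT -> K^o}.
HB.instance Definition _ := GRing.Lmodule.on grpalg.

Definition gelt (g : gT) : grpalg := [ffun x => (x == g)%:R].

Definition gmul (f h : grpalg) : grpalg :=
  [ffun x => \sum_y f y * h (y^-1 * x)%g].

Lemma gmulA : associative gmul.
Proof.
move=> f g h; apply/ffunP=> x; rewrite !ffunE.
under eq_bigr do rewrite ffunE mulr_sumr.
under [RHS]eq_bigr do rewrite ffunE mulr_suml.
rewrite [RHS]exchange_big; apply: eq_bigr => y _ /=.
rewrite (reindex_inj (mulgI y^-1%g)) /=; apply: eq_bigr => z _.
by rewrite mulrA invMg invgK !mulgA mulgK.
Qed.

Lemma gmul1l : left_id (gelt 1) gmul.
Proof.
move=> f; apply/ffunP=> x; rewrite !ffunE (bigD1 1%g) //= ffunE eqxx mul1r.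
rewrite invg1 mul1g big1 ?addr0 // => y /negPf y1.
by rewrite ffunE y1 mul0r.
Qed.

Lemma gmul1r : right_id (gelt 1) gmul.
Proof.
move=> f; apply/ffunP=> x; rewrite !ffunE (bigD1 x) //= ffunE mulVg eqxx mulr1.
rewrite big1 ?addr0 // => y /negPf yx.
by rewrite ffunE -eq_mulVg1 yx mulr0.
Qed.

Lemma gmulDl : left_distributive gmul +%R.
Proof.
move=> f g h; apply/ffunP=> x; rewrite !ffunE -big_split /=.
by apply: eq_bigr => y _; rewrite !ffunE mulrDl.
Qed.

Lemma gmulDr : right_distributive gmul +%R.
Proof.
move=> f g h; apply/ffunP=> x; rewrite !ffunE -big_split /=.
by apply: eq_bigr => y _; rewrite !ffunE mulrDr.
Qed.

HB.instance Definition _ := GRing.Zmodule_isPzRing.Build grpalg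
  gmulA gmul1l gmul1r gmulDl gmulDr.

Lemma g_scalerAl k (x y : grpalg) : k *: (x * y) = (k *: x) * y.
Proof.
apply/ffunP=> g; rewrite !ffunE scaler_sumr.
by apply: eq_bigr => h _; rewrite !ffunE scalerAl.
Qed.

Lemma g_scalerAr k (x y : grpalg) : k *: (x * y) = x * (k *: y).
Proof.
apply/ffunP=> g; rewrite !ffunE scaler_sumr.
by apply: eq_bigr => h _; rewrite !ffunE scalerAr.
Qed.

(* The group algebra is purely even. *)
Definition g_homog b (x : grpalg) := if b then x = 0 else True.

Lemma g_homog0 b : g_homog b 0.
Proof. by case: b. Qed.

Lemma g_homogP b (k : K) x y :
  g_homog b x -> g_homog b y -> g_homog b (k *: x + y).
Proof. by case: b => //= -> ->; rewrite scaler0 addr0. Qed.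

Lemma g_homog_split x : exists y z,
  [/\ g_homog false y, g_homog true z & x = y + z].
Proof. by exists x, 0; rewrite addr0. Qed.

Lemma g_homog_indep x : g_homog false x -> g_homog true x -> x = 0.
Proof. by []. Qed.

Lemma g_homogM b c x y :
  g_homog b x -> g_homog c y -> g_homog (b (+) c) (x * y).
Proof.
case: b; case: c => //=; first by move=> -> _; rewrite mul0r.
by move=> _ ->; rewrite mulr0.
Qed.

HB.instance Definition _ := PzRing_isSuperalgebra.Build K grpalg
  g_scalerAl g_scalerAr g_homog0 g_homogP g_homog_split g_homog_indep g_homogM.

Lemma geltM g h : gelt g * gelt h = gelt (g * h)%g.
Proof.
apply/ffunP=> x; rewrite !ffunE (bigD1 g) //= !ffunE eqxx mul1r.
rewrite big1 ?addr0 => [|y /negPf yg]; last by rewrite !ffunE yg mul0r.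
by rewrite (canF_eq (mulKVg g)).
Qed.

Lemma gelt1 : gelt 1%g = 1.
Proof. by []. Qed.

End GroupAlgebra.

Arguments gelt {K gT} g.

Section TensorModule.
Variables (K : comNzRingType) (A B : lmodType K).

Let pt (a : A) (b : B) : {malg K[(A * B)%type]} := << (a, b) >>.

Variant bilin_rel : {malg K[(A * B)%type]} -> Prop :=
| BilinL k a a' b : bilin_rel (pt (k *: a + a') b - (k *: pt a b + pt a' b))
| BilinR k a b b' : bilin_rel (pt a (k *: b + b') - (k *: pt a b + pt a b')).

Definition tens := quot bilin_rel.
HB.instance Definition _ := GRing.Lmodule.on tens.

Definition ptens_def a b : tens := qpi bilin_rel (pt a b).
Definition ptens := locked_with salg_key ptens_def.
Canonical ptens_unlockable := [unlockable fun ptens].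

Lemma ptensE a b : ptens a b = qpi bilin_rel (pt a b).
Proof. by rewrite unlock. Qed.

Lemma ptensL b : linear (ptens^~ b).
Proof.
move=> k a a'; rewrite !ptensE -linearP; apply/qpiP; apply: span_mem; exact: BilinL.
Qed.

Lemma ptensR a : linear (ptens a).
Proof.
move=> k b b'; rewrite !ptensE -linearP; apply/qpiP; apply: span_mem; exact: BilinR.
Qed.

HB.instance Definition _ a := GRing.isLinear.Build K B tens *:%R (ptens a)
  (ptensR a).

Lemma ptens0l b : ptens 0 b = 0.
Proof. by rewrite -[0 in LHS]addr0 -[X in X + _](scaler0 _ (-1)) ptensL scaleN1r addNr. Qed.

Lemma ptensDl a a' b : ptens (a + a') b = ptens a b + ptens a' b.
Proof. by rewrite -[a in LHS]scale1r ptensL scale1r. Qed.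

Lemma ptensZl k a b : ptens (k *: a) b = k *: ptens a b.
Proof. by rewrite -[k *: a]addr0 ptensL ptens0l addr0. Qed.

Lemma tens_ind (P : tens -> Prop) :
  (forall x y, P x -> P y -> P (x + y)) -> (forall a b, P (ptens a b)) ->
  forall x, P x.
Proof.
move=> PD PU; elim/quotW=> g; elim/malg_ind: g => [|g h Pg Ph|k [a b]].
- by rewrite linear0 -(ptens0l 0).
- by rewrite linearD; apply: PD.
by rewrite linearZ /= -ptensE -ptensZl.
Qed.

Definition bilin (W : lmodType K) (f : A -> B -> W) :=
  (forall b, linear (f^~ b)) /\ (forall a, linear (f a)).

Definition tlift (W : lmodType K) (f : A -> B -> W) : tens -> W :=
  qlift (flift (fun ab => f ab.1 ab.2)).

Lemma tlift_fun_linear (W : lmodType K) k (f g h : A -> B -> W) x :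
    (forall a b, h a b = k *: f a b + g a b) ->
  tlift h x = k *: tlift f x + tlift g x.
Proof.
move=> hE; rewrite /tlift /qlift /flift scaler_sumr -big_split /=.
by apply: eq_bigr => t _; rewrite hE scalerDr !scalerA mulrC.
Qed.

Section Lift.
Variables (W : lmodType K) (f : A -> B -> W) (fb : bilin f).

Let kill v : bilin_rel v -> flift (fun ab => f ab.1 ab.2) v = 0.
Proof.
set F := flift _; have Fl : linear F by apply: flift_linear.
have FB u w : F (u - w) = F u - F w.
  have -> : u - w = -1 *: w + u by rewrite scaleN1r addrC.
  by rewrite Fl scaleN1r addrC.
have FP a b : F (pt a b) = f a b by rewrite /F fliftU.
by case=> [k a a' b|k a b b']; rewrite FB Fl !FP ?fb.1 ?fb.2 subrr.
Qed.

Lemma tliftE a b : tlift f (ptens a b) = f a b.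
Proof.
rewrite /tlift ptensE qliftE ?fliftU //; exact: flift_linear.
Qed.

Lemma tlift_linear : linear (tlift f).
Proof. by apply: qlift_linear; [exact: flift_linear | exact: kill]. Qed.

End Lift.

End TensorModule.

Section TensorAlgebra.
Variables (K : comNzRingType) (A B : superAlgType K).

Definition stens := tens A B.
HB.instance Definition _ := GRing.Lmodule.on stens.

(* (a (x) b)(a' (x) b') = (-1)^(|b||a'|) aa' (x) bb', extended bilinearly from
   homogeneous b and a'; see stensM *)
Definition pmul a b a' b' : stens :=
  \sum_(p : bool) \sum_(q : bool)
    (-1) ^+ (p && q) *: ptens (a * hproj q a') (hproj p b * b').

Definition smul_def (x y : stens) : stens :=
  tlift (fun a b => tlift (pmul a b) y) x.
Definition smul := locked_with salg_key smul_def.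
Canonical smul_unlockable := [unlockable fun smul].

Lemma pmul_linear : [/\ forall b a' b', linear (fun a => pmul a b a' b'),
   forall a a' b', linear (fun b => pmul a b a' b'),
   forall a b b', linear (fun a' => pmul a b a' b')
 & forall a b a', linear (fun b' => pmul a b a' b')].
Proof.
rewrite /pmul; split=> y z t k u v; rewrite scaler_sumr -big_split /=;
  apply: eq_bigr => p _; rewrite scaler_sumr -big_split /=;
  apply: eq_bigr => q _; rewrite scalerA mulrC -scalerA -scalerDr; congr (_ *: _).
- by rewrite mulrDl -sscalerAl ptensL.
- by rewrite linearP mulrDl -sscalerAl ptensR.
- by rewrite linearP mulrDr -sscalerAr ptensL.
- by rewrite mulrDr -sscalerAr ptensR.
Qed.

Lemma pmul_bilin a b : bilin (pmul a b).
Proof. by case: pmul_linear => _ _ h3 h4; split=> ?; [apply: h3|apply: h4]. Qed.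

Lemma tlift_pmul_bilin y : bilin (fun a b => tlift (pmul a b) y).
Proof.
case: pmul_linear => h1 h2 _ _.
split=> [b k a a'|a k b b']; apply: tlift_fun_linear => c d.
  exact: (h1 b c d k a a').
exact: (h2 a c d k b b').
Qed.

Lemma smulE a b a' b' : smul (ptens a b) (ptens a' b') = pmul a b a' b'.
Proof.
by rewrite unlock /smul_def (tliftE (tlift_pmul_bilin _)) (tliftE (pmul_bilin _ _)).
Qed.

Lemma smul_linl y : linear (smul^~ y).
Proof. by rewrite unlock; exact: (tlift_linear (tlift_pmul_bilin y)). Qed.

Lemma smul_linr x : linear (smul x).
Proof.
move=> k y z; rewrite unlock; apply: tlift_fun_linear => a b.
exact: (tlift_linear (pmul_bilin a b)).
Qed.

Lemma smulDl : left_distributive smul +%R.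
Proof. by move=> x y z; rewrite -[x in LHS]scale1r smul_linl scale1r. Qed.

Lemma smulDr : right_distributive smul +%R.
Proof. by move=> x y z; rewrite -[y in LHS]scale1r smul_linr scale1r. Qed.

Lemma smulZl k x y : smul (k *: x) y = k *: smul x y.
Proof.
have h0 : smul 0 y = 0.
  by apply: (addrI (smul 0 y)); rewrite -smulDl !addr0.
by rewrite -[k *: x]addr0 smul_linl h0 addr0.
Qed.

Lemma smulZr k x y : smul x (k *: y) = k *: smul x y.
Proof.
have h0 : smul x 0 = 0.
  by apply: (addrI (smul x 0)); rewrite -smulDr !addr0.
by rewrite -[k *: y]addr0 smul_linr h0 addr0.
Qed.

Lemma smul_homog p q a b a' b' : homog p b -> homog q a' ->
  smul (ptens a b) (ptens a' b') = (-1) ^+ (p && q) *: ptens (a * a') (b * b').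
Proof.
move=> hb ha; rewrite smulE /pmul (bigD1 p) //= [X in _ + X]big1 => [|p' p'p].
  rewrite addr0 (bigD1 q) //= [X in _ + X]big1 => [|q' q'q].
    by rewrite addr0 (hproj_id hb) (hproj_id ha).
  by rewrite (hproj_if _ ha) (negPf q'q) mulr0 ptens0l scaler0.
apply: big1 => q' _.
by rewrite (hproj_if _ hb) (negPf p'p) mul0r linear0 scaler0.
Qed.

Lemma stens_ind (P : stens -> Prop) :
    (forall x y, P x -> P y -> P (x + y)) ->
    (forall p q a b, homog p a -> homog q b -> P (ptens a b)) ->
  forall x, P x.
Proof.
move=> PD PU; elim/tens_ind => // a b.
rewrite [a]hproj_sum [b]hproj_sum ptensDl ![ptens (hproj _ a) _]linearD /=.
by apply: (PD); apply: (PD); apply: PU (hproj_homog _ _) (hproj_homog _ _).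
Qed.

Lemma smulA : associative smul.
Proof.
elim/stens_ind=> [x x' IH IH' y z|p p' a a' ha ha'].
  by rewrite (smulDl x x' (smul y z)) (smulDl x x' y) smulDl IH IH'.
elim/stens_ind=> [y y' IH IH' z|q q' b b' hb hb'].
  rewrite (smulDl y y' z) (smulDr _ (smul y z) (smul y' z)) (smulDr _ y y').
  by rewrite (smulDl _ _ z) IH IH'.
elim/stens_ind=> [z z' IH IH'|r r' c c' hc hc'].
  by rewrite (smulDr _ z z') (smulDr _ (smul _ z) (smul _ z')) (smulDr _ z z') IH IH'.
rewrite (smul_homog _ _ hb' hc) (smul_homog _ _ ha' hb) smulZl smulZr.
rewrite (smul_homog _ _ ha' (homogM hb hc)) (smul_homog _ _ (homogM ha' hb') hc).
rewrite !scalerA !mulrA -!signr_addb; congr (_ ^+ _ *: _).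
by case: p' {ha'}; case: q {hb}; case: q' {hb'}; case: r {hc}.
Qed.

Definition sone : stens := ptens (1 : A) (1 : B).

Lemma smul1l : left_id sone smul.
Proof.
elim/stens_ind=> [x y IH IH'|p q a b ha hb]; first by rewrite (smulDr _ x y) IH IH'.
by rewrite (smul_homog _ _ (homog1 B) ha) !mul1r scale1r.
Qed.

Lemma smul1r : right_id sone smul.
Proof.
elim/stens_ind=> [x y IH IH'|p q a b ha hb]; first by rewrite (smulDl x y) IH IH'.
by rewrite (smul_homog _ _ hb (homog1 A)) !mulr1 andbF scale1r.
Qed.

HB.instance Definition _ := GRing.Zmodule_isPzRing.Build stens
  smulA smul1l smul1r smulDl smulDr.

Lemma stens_scalerAl k (x y : stens) : k *: (x * y) = (k *: x) * y.
Proof. by rewrite [in RHS]/GRing.mul /= smulZl. Qed.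

Lemma stens_scalerAr k (x y : stens) : k *: (x * y) = x * (k *: y).
Proof. by rewrite [in RHS]/GRing.mul /= smulZr. Qed.

Variant ptens_homog c : stens -> Prop :=
  PtensHomog p q a b of homog p a & homog q b & p (+) q = c :
    ptens_homog c (ptens a b).

Definition stens_homog c : stens -> Prop := span (ptens_homog c).

Lemma stens_homog0 c : stens_homog c 0.
Proof. exact: span0. Qed.

Lemma stens_homogP c (k : K) x y :
  stens_homog c x -> stens_homog c y -> stens_homog c (k *: x + y).
Proof. by move=> hx hy; apply: spanD => //; apply: spanZ. Qed.

Lemma stens_homog_split x : exists y z,
  [/\ stens_homog false y, stens_homog true z & x = y + z].
Proof.
elim/stens_ind: x => [x y [x0 [x1 [h0 h1 ->]]] [y0 [y1 [k0 k1 ->]]]|p q a b ha hb].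
  by exists (x0 + y0), (x1 + y1); rewrite addrACA; split=> //; apply: spanD.
have h : stens_homog (p (+) q) (ptens a b) by apply: span_mem; apply: PtensHomog ha hb _.
case: (p (+) q) h => h.
  by exists 0, (ptens a b); rewrite add0r; split=> //; apply: span0.
by exists (ptens a b), 0; rewrite addr0; split=> //; apply: span0.
Qed.

Let evf (a : A) (b : B) : stens :=
  ptens (hproj false a) (hproj false b) + ptens (hproj true a) (hproj true b).

Let evf_bilin : bilin evf.
Proof.
by split=> [b k a a'|a k b b']; rewrite /evf !linearP /= ?ptensL ?ptensR
  scalerDr addrACA.
Qed.

Let evE p q a b : homog p a -> homog q b ->
  tlift evf (ptens a b) = if p (+) q then 0 else ptens a b.
Proof.
move=> ha hb; rewrite (tliftE evf_bilin) /evf !(hproj_if _ ha) !(hproj_if _ hb).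
by case: p {ha}; case: q {hb};
   rewrite /= ?ptens0l ?linear0 ?addr0 ?add0r ?ptens0l ?linear0.
Qed.

Lemma stens_homog_indep x : stens_homog false x -> stens_homog true x -> x = 0.
Proof.
have L := tlift_linear evf_bilin.
have L0 : tlift evf 0 = 0.
  by rewrite -(ptens0l A (0 : B)) (evE (homog0 false) (homog0 true)) ptens0l.
move=> h0 h1.
have <- : tlift evf x = x.
  elim: h0 => [|k _ w [p q a b ha hb pq] _ IH]; first exact: L0.
  by rewrite L IH (evE ha hb) pq.
elim: h1 => [|k _ w [p q a b ha hb pq] _ IH]; first exact: L0.
by rewrite L IH (evE ha hb) pq scaler0 addr0.
Qed.

Lemma stens_homogM c d x y :
  stens_homog c x -> stens_homog d y -> stens_homog (c (+) d) (x * y).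
Proof.
move=> hx hy; elim: hx => [|k _ w [p q a b ha hb <-] _ IH].
  by rewrite mul0r; apply: span0.
rewrite mulrDl -stens_scalerAl; apply: spanD => //; apply: spanZ; move: IH => _.
elim: hy => [|l _ z [p' q' a' b' ha' hb' <-] _ IH].
  by rewrite mulr0; apply: span0.
rewrite mulrDr -stens_scalerAr; apply: spanD => //; apply: spanZ.
rewrite [_ * _](smul_homog _ _ hb ha'); apply/spanZ/span_mem.
by apply: PtensHomog (homogM ha ha') (homogM hb hb') _; rewrite addbACA.
Qed.

HB.instance Definition _ := PzRing_isSuperalgebra.Build K stens
  stens_scalerAl stens_scalerAr stens_homog0 stens_homogP stens_homog_split
  stens_homog_indep stens_homogM.

Definition stensor a b : stens := ptens a b.

Lemma stensM p q a b a' b' : homog p b -> homog q a' ->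
  stensor a b * stensor a' b' = (-1) ^+ (p && q) *: stensor (a * a') (b * b').
Proof. exact: smul_homog. Qed.

Lemma stens1 : stensor (1 : A) (1 : B) = 1.
Proof. by []. Qed.

End TensorAlgebra.

Notation "a '\ot' b" := (stensor a b) (at level 40, left associativity)
  : ring_scope.

Definition superalg_isomorphism (K : comNzRingType) (A B : superAlgType K)
    (f : A -> B) (g : B -> A) :=
  [/\ superalg_morphism f, superalg_morphism g, cancel f g & cancel g f].

Section Beta.
Variables (R : realType) (n : nat).
Implicit Types i j : 'I_n.

(* For j = i + 1 this is beta_i. *)
Definition beta i j : cliff R[i] n := (Num.sqrt 2)%:C%C^-1 *: (cgen i - cgen j).

(* The expression of beta_i in spinB, c_i being replaced by tpalin i. *)
Definition tbeta i j : spinB R[i] n :=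
  (Num.sqrt 2)%:C%C^-1 *: (tpalin i - tpalin j).

End Beta.

(* Main.v *)
Require Import Defs.
From mathcomp Require Import all_fingroup.
From mathcomp Require Import all_boot all_order all_algebra.
From mathcomp Require Import boolp reals.
From mathcomp.multinomials Require Import monalg.
From mathcomp.real_closed Require Import complex.

(** The two sides have presentations which mirror each other.

    In a Clifford algebra the vector beta_ij = (c_i - c_j) / sqrt 2 squares to 1
    and beta_ij c_k = - c_(s k) beta_ij, where s is the transposition (i j)
    ([root_vec_twists]): up to a sign, it conjugates the c_k as a permutation.
    Hence the adjacent beta_i together with c_n satisfy the relations of the
    spin Weyl group algebra.  Multiplying beta_i by the even element s_i, which
    commutes with everything Clifford and satisfies the ordinary Coxeter
    relations, does not destroy them; this gives phi.

    In the other direction, let C_i be the signed palindrome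
    t_i ... t_n ... t_i, that is C_n = t_n and C_i = - t_i C_(i+1) t_i.  The
    spin relations imply t_i C_k = - C_(s_i k) t_i for the non-final
    generators t_i ([spin_t_palin]), as well as C_i^2 = 1 and
    C_i C_j = - C_j C_i ([palin_sq], [palin_anticomm]).  So the C_i form a
    Clifford family on which t_i acts exactly as beta_i does.  The two twists
    cancel in beta_i t_i, which therefore commutes with every C_k; moving all
    the beta to the left, one sees that the elements beta_i t_i satisfy the
    Coxeter relations of the symmetric group ([spin_s_coxeter]).

    To turn this into a morphism psi one must know that the group algebra,
    given by its basis of permutations, is presented by the Coxeter relations
    ([symmetric_group_lift]).  This follows from a normal form: every word in
    adjacent transpositions is equivalent to one whose largest letter occurs at
    most once, at the head of a final descending run ([coxeter_normal_form]),
    and the run can be read off from the permutation.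

    Finally phi and psi are inverse to each other because they are so on
    generators: phi C_i = c_i by the reflection rule, and
    psi (phi t_i) = beta_i beta_i t_i = t_i.  The number sqrt 2 enters through
    a = 1 / sqrt 2, in the form a^2 + a^2 = 1, over any commutative ring. *)

Import GRing.Theory.
Local Open Scope ring_scope.

(** * Morphisms of superalgebras and universal properties *)

Section LinearFunction.
Variables (K : comNzRingType) (U V : lmodType K) (f : U -> V).
Hypothesis fl : linear f.

Lemma linear_fun0 : f 0 = 0.
Proof. by rewrite -[0 in LHS](addNr 0) -scaleN1r fl scaleN1r addNr. Qed.

Lemma linear_funD x y : f (x + y) = f x + f y.
Proof. by rewrite -[x in LHS]scale1r fl scale1r. Qed.

Lemma linear_funZ k x : f (k *: x) = k *: f x.
Proof. by rewrite -[k *: x]addr0 fl linear_fun0 addr0. Qed.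

Lemma linear_fun_sum (J : Type) (r : seq J) (F : J -> U) :
  f (\sum_(j <- r) F j) = \sum_(j <- r) f (F j).
Proof. exact: (big_morph f linear_funD linear_fun0). Qed.

End LinearFunction.

Arguments linear_fun0 {K U V f}.
Arguments linear_funD {K U V f}.
Arguments linear_funZ {K U V f}.
Arguments linear_fun_sum {K U V f}.

Section MorphismTheory.
Variables (K : comNzRingType) (A B : superAlgType K) (f : A -> B).
Hypothesis fP : superalg_morphism f.

Lemma smorM x y : f (x * y) = f x * f y.
Proof. by case: fP => _ _ h _; exact: h. Qed.

Lemma smor1 : f 1 = 1.
Proof. by case: fP. Qed.

Lemma smor_homog b x : homog b x -> homog b (f x).
Proof. by case: fP => _ _ _; apply. Qed.

Lemma smor_linear : linear f.
Proof. by case: fP. Qed.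

Lemma smorD x y : f (x + y) = f x + f y.
Proof. exact: (linear_funD smor_linear). Qed.

Lemma smorZ k x : f (k *: x) = k *: f x.
Proof. exact: (linear_funZ smor_linear). Qed.

Lemma smorN x : f (- x) = - f x.
Proof. by rewrite -scaleN1r smorZ scaleN1r. Qed.

Lemma smorB x y : f (x - y) = f x - f y.
Proof. by rewrite smorD smorN. Qed.

Lemma smorX x m : f (x ^+ m) = f x ^+ m.
Proof. by elim: m => [|m IH]; rewrite ?smor1 // !exprS smorM IH. Qed.

End MorphismTheory.

Arguments smorM {K A B f}.
Arguments smor1 {K A B f}.
Arguments smor_homog {K A B f}.
Arguments smor_linear {K A B f}.
Arguments smorD {K A B f}.
Arguments smorZ {K A B f}.
Arguments smorN {K A B f}.
Arguments smorB {K A B f}.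
Arguments smorX {K A B f}.

Lemma smor_comp (K : comNzRingType) (A B C : superAlgType K)
    (f : A -> B) (g : B -> C) :
  superalg_morphism f -> superalg_morphism g -> superalg_morphism (g \o f).
Proof.
move=> fP gP; split=> [k x y||x y|b x hx] /=.
- by rewrite (smor_linear fP) (smor_linear gP).
- by rewrite (smor1 fP) (smor1 gP).
- by rewrite (smorM fP) (smorM gP).
by apply: smor_homog => //; apply: smor_homog.
Qed.

Lemma smor_id (K : comNzRingType) (A : superAlgType K) :
  superalg_morphism (@id A).
Proof. by []. Qed.

(** The spanning family is described by its induction principle, which is the
    form in which the free algebra and the group algebra provide it. *)
Lemma multiplicative_on_span (K : comNzRingType) (A B : superAlgType K)
    (T : Type) (e : T -> A) (f : A -> B) :
    linear f ->
    (forall P : A -> Prop, P 0 -> (forall x y, P x -> P y -> P (x + y)) ->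
       (forall k t, P (k *: e t)) -> forall x, P x) ->
    (forall u v, f (e u * e v) = f (e u) * f (e v)) ->
  {morph f : x y / x * y}.
Proof.
move=> fl e_span fM; have fD := linear_funD fl; have fZ := linear_funZ fl.
have f0 := linear_fun0 fl.
move=> x y; elim/e_span: x => [|x x' IH IH'|k u].
- by rewrite mul0r f0 mul0r.
- by rewrite mulrDl !fD mulrDl IH IH'.
elim/e_span: y => [|y y' IH IH'|l v].
- by rewrite mulr0 f0 mulr0.
- by rewrite mulrDr !fD mulrDr IH IH'.
by rewrite -sscalerAl -sscalerAr !fZ -sscalerAl -sscalerAr fM.
Qed.

Section FreeLift.
Variables (K : comNzRingType) (I : choiceType).

Lemma freealg_lift (B : superAlgType K) (h : I -> B) :
    (forall i, homog true (h i)) ->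
  exists2 f : freealg K I -> B, superalg_morphism f & forall i, f (fgen i) = h i.
Proof.
move=> h_odd.
pose ev (w : {fmonom I}) : B := \prod_(i <- fmonom_val w) h i.
have ev_homog w : homog (odd (fdeg w)) (ev w).
  rewrite /ev /fdeg; elim: (fmonom_val w) => [|i s IH] /=.
    by rewrite big_nil; exact: homog1.
  rewrite big_cons -addTb; exact: homogM.
have L := flift_linear ev; set F : freealg K I -> B := flift ev in L *.
have FU w : F << w >> = ev w by exact: fliftU.
have FUM (u v : {fmonom I}) : F (<< u >> * << v >> : freealg K I) = ev u * ev v.
  have -> : << u >> * << v >> = << mmul u v >> :> freealg K I.
    by rewrite [LHS]malgM_def fgmulUU mulr1.
  by rewrite FU /ev fmM big_cat.
have FM : {morph F : x y / x * y}.
  apply: (multiplicative_on_span K (freealg K I) B _ (fun w => << w >>) F L).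
    exact: malg_ind.
  move=> u v.
  by rewrite FUM !FU.
exists F; last by move=> i; rewrite unlock FU /ev fmU big_seq1.
split.
- exact: L.
- by rewrite -[1]/(<< mone >>) FU /ev fm1 big_nil.
- exact: FM.
move=> b x hx.
rewrite /F /flift big_seq.
apply: big_ind => [|y z|w xw]; [exact: homog0|exact: homogD|].
by apply: homogZ; rewrite -(hx w) // mcoeff_neq0.
Qed.

End FreeLift.

Section QuotientLift.
Variables (K : comNzRingType) (A B : superAlgType K) (E : hrelations A).

Lemma squot_lift (f : A -> B) :
    superalg_morphism f -> (forall l r, E l r -> f l = f r) ->
  exists2 g : squot E -> B, superalg_morphism g & forall x, g (spi E x) = f x.
Proof.
move=> fP fE; case: (fP) => fl _ _ _.
have kill v : ideal_gen E v -> f v = 0.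
  case=> u w l r Elr.
  by rewrite !(smorM fP) (smorB fP) (fE _ _ Elr) subrr mulr0 mul0r.
pose g : squot E -> B := qlift f.
have gE x : g (spi E x) = f x by exact: (qliftE fl kill).
exists g => //; split.
- exact: (qlift_linear fl kill).
- by rewrite -(spi1 E) gE (smor1 fP).
- elim/squotW=> x; elim/squotW=> y.
  by rewrite -spiM !gE (smorM fP).
- move=> b _ [x hx ->]; rewrite gE; exact: smor_homog.
Qed.

End QuotientLift.

Section Presentation.
Variables (K : comNzRingType) (I : choiceType) (E : hrelations (freealg K I)).
Let gen i := spi E (fgen i).

(** The relations are between elements of the free algebra, so that their
    preservation is a statement about the morphism [f] extending [h]; its values
    on the generators are all that one needs to know about it. *)
Lemma presented_lift (B : superAlgType K) (h : I -> B) :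
    (forall i, homog true (h i)) ->
    (forall f : freealg K I -> B, superalg_morphism f ->
       (forall i, f (fgen i) = h i) -> forall l r, E l r -> f l = f r) ->
  exists2 g : squot E -> B, superalg_morphism g & forall i, g (gen i) = h i.
Proof.
move=> h_odd hE; have [f fP fh] := freealg_lift _ _ _ _ h_odd.
have [g gP gf] := squot_lift _ _ _ E f fP (hE f fP fh).
by exists g => // i; rewrite /gen gf fh.
Qed.

Lemma presented_ind (P : squot E -> Prop) :
    P 1 -> (forall x y, P x -> P y -> P (x + y)) ->
    (forall k x, P x -> P (k *: x)) -> (forall i x, P x -> P (gen i * x)) ->
  forall x, P x.
Proof.
move=> P1 PD PZ PM; elim/squotW => x; elim/malg_ind: x => [|x y Px Py|k w].
- by rewrite linear0 -(scale0r (1 : squot E)); apply: PZ.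
- by rewrite linearD; apply: PD.
rewrite linearZ; apply: PZ => /=.
case: w => s; elim: s => [|i s IH].
  suff -> : << FMonom [::] >> = 1 :> freealg K I by rewrite spi1.
  by transitivity (<< mone >> : freealg K I); rewrite // /mone /= fmoneE.
suff -> : << FMonom (i :: s) >> = fgen i * << FMonom s >> :> freealg K I.
  by rewrite spiM; apply: PM.
by rewrite unlock [RHS]malgM_def fgmulUU mulr1 /mmul /= fmmulE fmuE.
Qed.

Lemma presented_eq (B : superAlgType K) (f g : squot E -> B) :
    superalg_morphism f -> superalg_morphism g ->
  (forall i, f (gen i) = g (gen i)) -> f =1 g.
Proof.
move=> fP gP fg; apply: presented_ind => [|x y|k x|i x].
- by rewrite (smor1 fP) (smor1 gP).
- by rewrite (smorD fP) (smorD gP) => -> ->.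
- by rewrite (smorZ fP) (smorZ gP) => ->.
by rewrite (smorM fP) (smorM gP) => ->; rewrite fg.
Qed.

End Presentation.

Section GroupAlgebraLift.
Variables (K : comNzRingType) (gT : finGroupType).

Lemma grpalg_decomp (x : grpalg K gT) : x = \sum_g x g *: gelt g.
Proof.
apply/ffunP=> g; rewrite sum_ffunE (bigD1 g) //= !ffunE eqxx.
rewrite big1 => [|h /negPf hg]; first by rewrite addr0 [RHS]mulr1.
by rewrite !ffunE eq_sym hg scaler0.
Qed.

Lemma grpalg_lift (B : superAlgType K) (h : gT -> B) :
    h 1%g = 1 -> {morph h : u v / (u * v)%g >-> u * v} ->
    (forall g, homog false (h g)) ->
  exists2 f : grpalg K gT -> B, superalg_morphism f & forall g, f (gelt g) = h g.
Proof.
move=> h1 hM h_even.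
pose f (x : grpalg K gT) : B := \sum_g (x g : K) *: h g.
have fE g : f (gelt g) = h g.
  rewrite /f (bigD1 g) //= ffunE eqxx scale1r big1 ?addr0 // => u /negPf ug.
  by rewrite ffunE ug scale0r.
have fl : linear f.
  move=> k x y; rewrite /f scaler_sumr -big_split /=; apply: eq_bigr => g _.
  by rewrite !ffunE scalerDl scalerA.
exists f => //; split=> //.
- by rewrite -gelt1 fE h1.
- apply: (multiplicative_on_span K (grpalg K gT) B _ gelt f fl) => [P P0 PD PU x|u v].
    by rewrite (grpalg_decomp x); apply: (big_ind P) => // g _; exact: PU.
  by rewrite geltM !fE hM.
- case=> x; first by move=> ->; rewrite (linear_fun0 fl); exact: homog0.
  move=> _; rewrite /f; apply: big_ind => [|y z|g _]; [exact: homog0|exact: homogD|].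
  exact: homogZ.
Qed.

End GroupAlgebraLift.

Section TensorLift.
Variables (K : comNzRingType) (A B C : superAlgType K).

Lemma stens_lift (f : A -> C) (g : B -> C) :
    superalg_morphism f -> superalg_morphism g ->
    (forall p q b a, homog p b -> homog q a ->
       g b * f a = (-1) ^+ (p && q) *: (f a * g b)) ->
  exists2 h : stens A B -> C, superalg_morphism h &
    forall a b, h (a \ot b) = f a * g b.
Proof.
move=> fP gP fg; pose fb (a : A) (b : B) := f a * g b.
have fbB : bilin fb.
  split=> [b k a a'|a k b b']; rewrite /fb.
    by rewrite (smor_linear fP) mulrDl -sscalerAl.
  by rewrite (smor_linear gP) mulrDr -sscalerAr.
pose h : stens A B -> C := tlift fb.
have hE a b : h (a \ot b) = f a * g b by exact: (tliftE fbB).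
have hl : linear h by exact: (tlift_linear fbB).
have hD := linear_funD hl; have hZ := linear_funZ hl.
exists h => //; split=> //.
- by rewrite -stens1 hE (smor1 fP) (smor1 gP) mulr1.
- move=> x y; elim/stens_ind: x => [x x' IH IH'|p p' a b ha hb].
    by rewrite mulrDl !hD mulrDl IH IH'.
  elim/stens_ind: y => [y y' IH IH'|q q' a' b' ha' hb'].
    by rewrite mulrDr !hD mulrDr IH IH'.
  rewrite -![ptens _ _]/(_ \ot _) (stensM _ _ hb ha') hZ !hE.
  rewrite (smorM fP) (smorM gP) -[RHS]mulrA.
  rewrite [in RHS](mulrA (g b)) (fg _ _ _ _ hb ha') -sscalerAl -sscalerAr.
  by rewrite !mulrA.
- move=> c x hx; elim: hx => [|k _ w [p q a b ha hb <-] _ IH].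
    by rewrite (linear_fun0 hl); exact: homog0.
  rewrite hl; apply: homogP => //; rewrite -[ptens _ _]/(_ \ot _) hE.
  by apply: homogM; apply: smor_homog.
Qed.

End TensorLift.

Lemma squot_rel (K : comNzRingType) (A : superAlgType K) (E : hrelations A) l r :
  E l r -> spi E l = spi E r.
Proof.
move=> Elr; apply/qpiP; apply: span_mem.
by rewrite -[l - r]mulr1 -[l - r]mul1r; apply: IdealGen.
Qed.

Lemma spiX (K : comNzRingType) (A : superAlgType K) (E : hrelations A) x k :
  spi E (x ^+ k) = spi E x ^+ k.
Proof. by elim: k => [|k IH]; rewrite ?spi1 // !exprS spiM IH. Qed.

Section TensorWithGroupAlgebra.
Variable K : comNzRingType.

Lemma tensorDl (A C : superAlgType K) (x x' : A) (y : C) :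
  (x + x') \ot y = x \ot y + x' \ot y.
Proof. exact: ptensDl. Qed.

(** No Koszul sign appears, whatever the parity of [y], since the group algebra
    is even. *)
Lemma tensorM (A : superAlgType K) (gT : finGroupType) (x y : A)
    (g h : grpalg K gT) :
  (x \ot g) * (y \ot h) = (x * y) \ot (g * h).
Proof.
have homogM q z : homog q z -> (x \ot g) * (z \ot h) = (x * z) \ot (g * h).
  by move=> hz; rewrite (stensM (p := false) _ _ _ hz) // scale1r.
rewrite (hproj_sum y) [in RHS]mulrDr !tensorDl mulrDr.
by rewrite !(homogM _ _ (hproj_homog _ _)).
Qed.

Lemma tensorN (A C : superAlgType K) (x : A) (y : C) : (- x) \ot y = - (x \ot y).
Proof. by rewrite -!scaleN1r /stensor ptensZl. Qed.

Lemma tensor_homog (A : superAlgType K) (gT : finGroupType) b (x : A)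
    (g : grpalg K gT) : homog b x -> homog b (x \ot g).
Proof.
move=> hx; apply: span_mem; rewrite -[b]addbF.
exact: (PtensHomog hx (I : homog false g) erefl).
Qed.

Lemma tensorX (A : superAlgType K) (gT : finGroupType) (x : A) (g : grpalg K gT) m :
  (x \ot g) ^+ m = (x ^+ m) \ot (g ^+ m).
Proof. by elim: m => [|m IH]; rewrite ?stens1 // !exprS IH tensorM. Qed.

End TensorWithGroupAlgebra.

(** * The Coxeter presentation of the symmetric group *)

(** The relations between the [n] simple reflections of type A_n.  The operation
    is arbitrary because they are needed both for permutations and for elements
    of an algebra. *)
Definition coxeter_typeA (n : nat) (T : Type) (e : T) (op : T -> T -> T)
    (s : nat -> T) :=
  [/\ forall i, (i < n)%N -> op (s i) (s i) = e,
      forall i, (i.+1 < n)%N ->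
        op (op (s i) (s i.+1)) (s i) = op (op (s i.+1) (s i)) (s i.+1)
    & forall i j, (i.+1 < j)%N -> (j < n)%N -> op (s i) (s j) = op (s j) (s i)].

(** The word m-1, ..., k.  As a product of adjacent transpositions it sends m to
    k, and these words represent the cosets of S_m in S_(m+1). *)
Definition descent k m := rev (iota k (m - k)).

Lemma descentS k m : (k <= m)%N -> descent k m.+1 = m :: descent k m.
Proof.
by move=> km; rewrite /descent subSn // -addn1 iotaD subnKC // rev_cat.
Qed.

Section CoxeterWords.
Variables (n : nat) (T : Type) (e : T) (op : Monoid.law e) (s : nat -> T).
Hypothesis sP : coxeter_typeA n T e op s.

Local Notation "x * y" := (op x y).
Let ev (w : seq nat) : T := \big[op/e]_(i <- w) s i.
Let D k m := ev (descent k m).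

Let opA : associative op := Monoid.mulmA op.

Lemma ev_cat u v : ev (u ++ v) = ev u * ev v.
Proof. exact: big_cat. Qed.

Lemma ev1 i : ev [:: i] = s i.
Proof. exact: big_seq1. Qed.

Lemma descent_split k i m : (k <= i <= m)%N -> D k m = D i m * D k i.
Proof.
case/andP=> ki im; rewrite -ev_cat -rev_cat; congr (ev (rev _)).
by rewrite -{2}(subnKC ki) -iotaD addnBAC // subnKC // (leq_trans ki).
Qed.

Lemma descent_self m : D m m = e.
Proof. by rewrite /D /descent subnn /ev big_nil. Qed.

Lemma descent_step k m : (k < m)%N -> D k.+1 m * s k = D k m.
Proof.
move=> km; rewrite [RHS](descent_split k k.+1) ?leqnSn //; congr (_ * _).
by rewrite /D /descent subSnn ev1.
Qed.

Lemma descent_cancel k m : (k < m)%N -> (m <= n)%N -> D k m * s k = D k.+1 m.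
Proof.
move=> km mn; rewrite -descent_step // -opA; case: sP => -> // *.
  by rewrite Monoid.mulm1.
exact: leq_trans mn.
Qed.

Lemma ev_commute i w :
  (forall j, j \in w -> s i * s j = s j * s i) -> s i * ev w = ev w * s i.
Proof.
elim: w => [|j w IH] h; first by rewrite /ev big_nil Monoid.mulm1 Monoid.mul1m.
rewrite /ev big_cons opA h ?mem_head // -opA IH ?opA // => k kw.
by apply: h; rewrite inE kw orbT.
Qed.

Lemma mem_descent j k m : (j \in descent k m) = (k <= j < m)%N.
Proof.
rewrite mem_rev mem_iota; case: (leqP k m) => [km|mk]; first by rewrite subnKC.
move: (ltnW mk); rewrite -subn_eq0 => /eqP ->; rewrite addn0.
by case: (leqP k j) => //= kj; rewrite ltnNge (leq_trans (ltnW mk) kj).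
Qed.

Lemma descent_commute_low i k m : (i.+1 < k)%N -> (m <= n)%N ->
  s i * D k m = D k m * s i.
Proof.
move=> ik mn; apply: ev_commute => j; rewrite mem_descent => /andP [kj jm].
by case: sP => _ _; apply; [exact: leq_trans kj | exact: leq_trans mn].
Qed.

Lemma descent_commute_high i k m : (m < i)%N -> (i < n)%N ->
  s i * D k m = D k m * s i.
Proof.
move=> mi ni; apply: ev_commute => j; rewrite mem_descent => /andP [kj jm].
by case: sP => _ _ h; rewrite (h j i) //; exact: leq_ltn_trans mi.
Qed.

(** Split the run as (m-1 ... j+2) (j+1) (j) (j-1 ... k).  The letter j+1 commutes
    with the right part, the braid relation turns (j+1) j (j+1) into
    j (j+1) j, and the new j on the left commutes with the left part. *)
Lemma descent_braid k j m : (k <= j)%N -> (j.+1 < m)%N -> (m <= n)%N ->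
  D k m * s j.+1 = s j * D k m.
Proof.
move=> kj jm mn.
have jn : (j.+1 < n)%N by exact: leq_trans mn.
have -> : D k m = D j.+2 m * s j.+1 * s j * D k j.
  rewrite descent_step // descent_step ?(ltnW jm) //.
  by rewrite (descent_split k j) // kj ltnW // ltnW.
rewrite -!opA -descent_commute_high // !opA descent_commute_low //.
case: sP => _ br _; move: (br _ jn) => {}br.
by congr (_ * _); rewrite -!opA; congr (_ * _); rewrite !opA br.
Qed.

End CoxeterWords.

(** Equality in the abstract Coxeter group, expressed by its interpretations in
    all monoids. *)
Definition word_eq n (w w' : seq nat) :=
  forall (T : Type) (e : T) (op : Monoid.law e) (s : nat -> T),
    coxeter_typeA n T e op s ->
  \big[op/e]_(i <- w) s i = \big[op/e]_(i <- w') s i.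

(** Words of this shape are stable under right multiplication by a letter i: if
    i < k - 1 it moves through the run, if i = k - 1 it extends the run, if i = k
    it cancels the last letter, and if i > k it leaves on the left as i - 1
    ([descent_braid]). *)
Lemma coxeter_normal_form n m w :
    (m <= n)%N -> all (ltn^~ m) w ->
  exists u k, [/\ (k <= m)%N, all (ltn^~ m.-1) u & word_eq n w (u ++ descent k m)].
Proof.
move=> mn; elim/last_ind: w => [_|w i IH].
  exists [::], m; split=> // T e op s sP.
  by rewrite /= descent_self big_nil.
rewrite all_rcons => /andP [im /IH [u [k [km um wE]]]].
have step u' k' : (k' <= m)%N -> all (ltn^~ m.-1) u' ->
    (forall (T : Type) (e : T) (op : Monoid.law e) (s : nat -> T),
      coxeter_typeA n T e op s ->
      op (\big[op/e]_(j <- descent k m) s j) (s i) =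
      op (\big[op/e]_(j <- u') s j) (\big[op/e]_(j <- descent k' m) s j)) ->
  exists v l, [/\ (l <= m)%N, all (ltn^~ m.-1) v
    & word_eq n (rcons w i) (v ++ descent l m)].
  move=> k'm u'm uE; exists (u ++ u'), k'; split=> // [|T e op s sP].
    by rewrite all_cat um.
  rewrite -cats1 big_cat (wE T e op s sP) /= !big_cat big_seq1 /=.
  by rewrite -!Monoid.mulmA; congr (op _ _); exact: uE.
have m_gt0 : (0 < m)%N by exact: leq_ltn_trans im.
case: (ltngtP i k) => [ik|ki|ik].
- move: ik; rewrite leq_eqVlt => /orP [/eqP ik|ik].
    apply: (step [::] i) => // [|T e op s sP]; first exact: ltnW.
    by rewrite -ik descent_step // big_nil Monoid.mul1m.
  apply: (step [:: i] k) => // [|T e op s sP].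
    by rewrite /= andbT -ltnS prednK // (leq_trans ik).
  by rewrite big_seq1 (descent_commute_low n).
- case: i ki im IH step => // j kj jm _ step.
  apply: (step [:: j] k) => // [|T e op s sP].
    by rewrite /= andbT -ltnS prednK.
  by rewrite big_seq1 (descent_braid n).
- apply: (step [::] k.+1) => // [|T e op s sP]; first by rewrite -ik.
  by rewrite big_nil Monoid.mul1m ik (descent_cancel n) // -ik.
Qed.

Section SymmetricGroup.
Variable n : nat.

Definition adjacent (i : nat) : 'S_n.+1 := tperm (inord i) (inord i.+1).

Lemma inord_neq i j : (i < j <= n)%N -> (inord i : 'I_n.+1) != inord j.
Proof.
case/andP=> ij jn; rewrite -val_eqE /= !inordK ?neq_ltn ?ij //.
by rewrite ltnS (leq_trans (ltnW ij)).
Qed.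

Lemma tperm_braid (T : finType) (x y z : T) : x != y -> y != z -> x != z ->
  (tperm x y * tperm y z * tperm x y = tperm y z * tperm x y * tperm y z)%g.
Proof.
move=> xy yz xz.
have -> : (tperm x y * tperm y z * tperm x y = tperm y z ^ tperm x y)%g.
  by rewrite /conjg tpermV mulgA.
have -> : (tperm y z * tperm x y * tperm y z = tperm x y ^ tperm y z)%g.
  by rewrite /conjg tpermV mulgA.
by rewrite !tpermJ tpermR tpermL !tpermD // eq_sym.
Qed.

Lemma adjacent_coxeter : coxeter_typeA n 'S_n.+1 1%g mulg adjacent.
Proof.
split=> [i ilt|i ilt|i j ij jlt]; first exact: tperm2.
  have i1 : (i < n)%N by exact: ltnW.
  by apply: tperm_braid; apply: inord_neq; rewrite ?ltnSn ?ltnS ?leqnSn ?ilt ?i1.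
have h k l : (k <= i.+1)%N -> (j <= l <= j.+1)%N -> (inord l : 'I_n.+1) != inord k.
  move=> ki /andP [jl lj]; rewrite eq_sym; apply: inord_neq.
  by rewrite (leq_trans lj jlt) andbT (leq_trans _ jl) // (leq_trans _ ij).
by apply/commgP/conjg_fixP; rewrite tpermJ !tpermD //; apply: h; rewrite ?leqnn ?leqnSn.
Qed.

Lemma word_fixes m (w : seq nat) : (m < n)%N -> all (ltn^~ m) w ->
  (\prod_(i <- w) adjacent i)%g (inord m.+1) = inord m.+1.
Proof.
move=> mn; elim: w => [|i w IH] /=; first by rewrite big_nil perm1.
case/andP=> im wm; rewrite big_cons permM tpermD ?IH //; apply: inord_neq => //.
  by rewrite mn ltnS (ltnW im).
by rewrite mn ltnS im.
Qed.

Lemma descent_moves k m : (k <= m)%N -> (m <= n)%N ->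
  (\prod_(i <- descent k m) adjacent i)%g (inord m) = inord k.
Proof.
elim: m => [|m IH] km mn.
  by move: km; rewrite leqn0 => /eqP ->; rewrite /descent big_nil perm1.
move: km; rewrite leq_eqVlt => /orP [/eqP ->|km].
  by rewrite /descent subnn big_nil perm1.
rewrite descentS // big_cons.
by rewrite permM tpermR IH // ltnW.
Qed.

(** In the normal form u (m ... k), the letters of u fix m+1 while the run sends
    m+1 to k; if the product is 1 the run is empty, and induction applies
    to u. *)
Lemma trivial_word m (w : seq nat) : (m <= n)%N -> all (ltn^~ m) w ->
    (\prod_(i <- w) adjacent i = 1)%g -> word_eq n w [::].
Proof.
elim: m w => [|m IH] w mn wm w1.
  by case: w wm {w1} => // _ T e op s _; rewrite big_nil.
have [u [k [km um wE]]] := coxeter_normal_form n m.+1 w mn wm.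
have := wE _ _ mulg adjacent adjacent_coxeter; rewrite w1 big_cat /=.
(* Follow the top letter: u fixes it and the descending tail sends it to k. *)
move/(congr1 (fun p : 'S_n.+1 => p (inord m.+1))) => /=.
rewrite perm1 permM word_fixes //.
rewrite descent_moves // => /(congr1 val); rewrite /= !inordK // => [mk|].
  have := wE; rewrite -mk /descent subnn cats0 => {}wE.
  have u1 : (\prod_(i <- u) adjacent i = 1)%g.
    by rewrite -(wE _ _ mulg adjacent adjacent_coxeter).
  move=> T e op s sP; rewrite (wE T e op s sP); exact: (IH u (ltnW mn) um u1).
exact: leq_ltn_trans km _.
Qed.

Definition word_product (w : seq nat) : 'S_n.+1 := (\prod_(i <- w) adjacent i)%g.

(** Permutations are products of transpositions, and (i j+1) is the conjugate of
    (i j) by (j j+1). *)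
Lemma word_product_surj (p : 'S_n.+1) :
  exists2 w, all (ltn^~ n) w & word_product w = p.
Proof.
have tw d i : (i + d.+1 <= n)%N -> exists2 w, all (ltn^~ n) w &
    word_product w = tperm (inord i) (inord (i + d.+1)).
  elim: d => [|d IH] h.
    exists [:: i]; first by rewrite /= andbT -addn1.
    by rewrite /word_product big_seq1 /adjacent addn1.
  have h' : (i + d.+1 < n)%N by rewrite -addnS.
  have [w wn wE] := IH (ltnW h').
  exists ((i + d.+1)%N :: rcons w (i + d.+1)%N).
    by rewrite /= all_rcons h' wn.
  rewrite /word_product big_cons -cats1 big_cat big_seq1 /=.
  rewrite -/(word_product w) wE.
  set t := adjacent _; have tV : (t^-1 = t)%g by exact: tpermV.
  rewrite -{1}tV -/(conjg _ t) tpermJ tpermD; last 2 first.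
  - by rewrite eq_sym; apply: inord_neq; rewrite (ltnW h') andbT -addn1 leq_add2l.
  - by rewrite eq_sym; apply: inord_neq; rewrite h' andbT ltnS leq_addr.
  by rewrite tpermL [in RHS]addnS.
have [ts -> _] := prod_tpermP p.
elim: ts => [|[a b] ts [w wn wE]].
  by exists [::]; rewrite // /word_product !big_nil.
suff [v vn vE] : exists2 v, all (ltn^~ n) v & word_product v = tperm a b.
  exists (v ++ w); first by rewrite all_cat vn.
  by rewrite /word_product big_cat -/(word_product v) -/(word_product w) vE wE big_cons.
wlog ab : a b / (a <= b)%N.
  by move=> h; case/orP: (leq_total a b) => [/h //|/h]; rewrite tpermC.
move: ab; rewrite leq_eqVlt => /orP [/eqP/val_inj ->|ab].
  by exists [::]; rewrite // /word_product big_nil tperm1.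
have bE : (b : nat) = (a + (b - a.+1).+1)%N by rewrite addnS -addSn subnKC.
have [|v vn vE] := tw (b - a.+1)%N a; first by rewrite -bE -ltnS.
by exists v; rewrite // vE -bE !inord_val.
Qed.

Lemma adjacent_ind (P : 'S_n.+1 -> Prop) :
    P 1%g -> (forall i p, (i < n)%N -> P p -> P (adjacent i * p)%g) ->
  forall p, P p.
Proof.
move=> P1 PM p; have [w wn <-] := word_product_surj p.
elim: w wn => [|i w IH] /=; first by rewrite /word_product big_nil.
by case/andP=> i_n /IH h; rewrite /word_product big_cons; apply: PM.
Qed.

(** The image of a permutation is the value of any word for it.  Two words w and
    w' for the same permutation have the same value, since w followed by the
    reversal of w' is trivial. *)
Lemma symmetric_group_lift (T : Type) (e : T) (op : Monoid.law e) (s : nat -> T) :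
    coxeter_typeA n T e op s ->
  exists f : 'S_n.+1 -> T,
    [/\ f 1%g = e, forall p q, f (p * q)%g = op (f p) (f q)
      & forall i, (i < n)%N -> f (adjacent i) = s i].
Proof.
move=> sP; pose ev w : T := \big[op/e]_(i <- w) s i.
have wordP p : exists w, all (ltn^~ n) w /\ word_product w = p.
  by have [w wn wE] := word_product_surj p; exists w.
pose f p := ev (sval (cid (wordP p))).
have revK (w : seq nat) : all (ltn^~ n) w -> forall (T' : Type) (e' : T')
    (op' : Monoid.law e') (s' : nat -> T'), coxeter_typeA n T' e' op' s' ->
    op' (\big[op'/e']_(i <- rev w) s' i) (\big[op'/e']_(i <- w) s' i) = e'.
  move=> wn T' e' op' s' [s'K _ _]; elim: w wn => [|i w IH] /=.
    by rewrite !big_nil Monoid.mulm1.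
  case/andP=> i_n /IH h; rewrite rev_cons -cats1 big_cat /= big_seq1 big_cons.
  have opA : associative op' := Monoid.mulmA op'.
  by rewrite -opA (opA (s' i)) s'K // Monoid.mul1m.
have evE w w' : all (ltn^~ n) w -> all (ltn^~ n) w' ->
    word_product w = word_product w' -> ev w = ev w'.
  move=> wn wn' ww.
  have t1 : word_eq n (w ++ rev w') [::].
    apply: (trivial_word n) => //; first by rewrite all_cat wn all_rev.
    rewrite big_cat /= -/(word_product w) ww.
    apply: (mulIg (word_product w')).
    have ww' := revK _ wn' _ _ mulg _ adjacent_coxeter.
    by rewrite -mulgA [X in (_ * X)%g]ww' mulg1 mul1g.
  have opA : associative op := Monoid.mulmA op.
  have h : op (ev w) (ev (rev w')) = e.
    by have := t1 _ _ op s sP; rewrite big_cat big_nil.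
  have := congr1 (op (ev w)) (revK w' wn' _ _ op s sP).
  by rewrite opA h Monoid.mul1m Monoid.mulm1.
have fE w : all (ltn^~ n) w -> f (word_product w) = ev w.
  by rewrite /f; case: cid => v /= [vn vE] wn; exact: evE.
exists f; split=> [|p q|i i_n].
- have -> : 1%g = word_product [::] by rewrite /word_product big_nil.
  by rewrite fE // /ev big_nil.
- have [w wn <-] := word_product_surj p; have [v vn <-] := word_product_surj q.
  rewrite -big_cat /= -/(word_product (w ++ v)) !fE ?all_cat ?wn // /ev.
  by rewrite big_cat.
have -> : adjacent i = word_product [:: i] by rewrite /word_product big_seq1.
by rewrite fE /= ?i_n // /ev big_seq1.
Qed.

End SymmetricGroup.

(** * Reflections in a Clifford algebra *)

Section Anticommutation.
Variable A : pzRingType.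

Definition anticomm (x y : A) := x * y = - (y * x).

Lemma anticomm_sym x y : anticomm x y -> anticomm y x.
Proof. by rewrite /anticomm => ->; rewrite opprK. Qed.

Lemma anticommN x y : anticomm x y -> anticomm x (- y).
Proof. by rewrite /anticomm mulrN mulNr => ->. Qed.

(** Three exchanges give an odd number of signs. *)
Lemma anticomm3 x u v w : anticomm x u -> anticomm x v -> anticomm x w ->
  anticomm x (u * v * w).
Proof.
rewrite /anticomm => xu xv xw.
rewrite !mulrA xu !mulNr -(mulrA u) xv mulrN mulNr opprK mulrA.
by rewrite -(mulrA _ x) xw mulrN !mulrA.
Qed.

Lemma anticomm_of_sq x y : x * x = 1 -> y * y = 1 -> (x * y) ^+ 2 = -1 ->
  anticomm x y.
Proof.
move=> x2 y2 /(congr1 ( *%R^~ (y * x))) /=; rewrite expr2 mulN1r !mulrA.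
by rewrite -(mulrA (x * y * x)) y2 mulr1 -(mulrA (x * y)) x2 mulr1.
Qed.

Lemma sq_of_anticomm x y : x * x = 1 -> y * y = 1 -> anticomm x y ->
  (x * y) ^+ 2 = -1.
Proof.
move=> x2 y2 xy; rewrite expr2 {1}xy mulNr mulrA -(mulrA y) x2 mulr1 y2 //.
Qed.

End Anticommutation.

Section CliffordFamily.
Variables (K : comNzRingType) (A : superAlgType K) (I : finType).
Variables (a : K) (c : I -> A).
Hypothesis a_half : a * a + a * a = 1.
Hypothesis c_sq : forall i, c i * c i = 1.
Hypothesis c_anti : forall i j, i != j -> anticomm A (c i) (c j).

(** With a = 1 / sqrt 2, the unit vector orthogonal to the mirror of the
    transposition (i j). *)
Definition root_vec i j : A := a *: (c i - c j).
Local Notation beta := root_vec.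

(** Up to the sign of an odd [x] passing an odd generator, moving [x] through the
    generators permutes them by [p]. *)
Definition twists (x : A) (p : {perm I}) :=
  forall k, x * c k = - (c (p k) * x).

Lemma twists_root_vec x p i j : twists x p ->
  x * beta i j = - (beta (p i) (p j) * x).
Proof.
move=> xp; rewrite /root_vec -sscalerAr -sscalerAl mulrBr !xp -scalerN; congr (_ *: _).
by rewrite mulrBl opprB addrC opprK.
Qed.

Lemma root_vec_twists i j : i != j -> twists (beta i j) (tperm i j).
Proof.
move=> ij k; rewrite /root_vec -sscalerAr -sscalerAl -scalerN; congr (_ *: _).
rewrite mulrBl mulrBr opprB.
case: tpermP => [->|->|/eqP ki /eqP kj].
- by rewrite c_sq c_sq.
- by rewrite !c_sq.
by rewrite (c_anti _ _ ki) (c_anti _ _ kj) opprK addrC.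
Qed.

Lemma root_vec_sq i j : i != j -> beta i j * beta i j = 1.
Proof.
move=> ij; rewrite /root_vec -sscalerAl -sscalerAr scalerA mulrBl !mulrBr.
rewrite !c_sq (c_anti _ _ ij) opprK opprB addrACA subrr addr0.
by rewrite scalerDr -scalerDl a_half scale1r.
Qed.

Lemma root_vec_anticomm i j k l : i != j -> k != i -> k != j -> l != i -> l != j ->
  anticomm A (beta i j) (beta k l).
Proof.
move=> ij ki kj li lj; rewrite /anticomm.
rewrite (twists_root_vec _ _ _ _ (root_vec_twists _ _ ij)).
by rewrite !tpermD // eq_sym.
Qed.

(** By the twisting rule both sides are equal to minus the vector attached to
    (i k). *)
Lemma root_vec_braid i j k : i != j -> j != k -> i != k ->
  beta i j * beta j k * beta i j = beta j k * beta i j * beta j k.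
Proof.
move=> ij jk ik.
rewrite (twists_root_vec _ _ _ _ (root_vec_twists _ _ ij)).
rewrite (twists_root_vec _ _ _ _ (root_vec_twists _ _ jk)).
rewrite tpermR tpermL (tpermD ik jk) tpermD ?[_ == i]eq_sym // !mulNr -!mulrA.
by rewrite !root_vec_sq.
Qed.

(** Twisting gives (beta c_j)^2 = - c_i c_j, whose square is -1. *)
Lemma root_vec_last i j : i != j -> (beta i j * c j) ^+ 4 = -1.
Proof.
move=> ij; have bc2 : (beta i j * c j) ^+ 2 = - (c i * c j).
  rewrite expr2 {1}root_vec_twists // tpermR mulNr mulrA -(mulrA (c i)).
  by rewrite root_vec_sq // mulr1.
rewrite -[4%N]/(2 * 2)%N exprM bc2 sqrrN expr2 {1}c_anti // mulNr.
by rewrite mulrA -(mulrA (c j)) c_sq mulr1 c_sq.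
Qed.

Section Untwist.
Variables (i j : I) (x : A).
Hypotheses (ij : i != j) (x_twists : twists x (tperm i j)).

(** Passing c_k, both [x] and the root vector permute the index and give a sign;
    permutations and signs cancel. *)
Lemma untwist_commute k : beta i j * x * c k = c k * (beta i j * x).
Proof.
rewrite -[LHS]mulrA x_twists mulrN [in LHS]mulrA root_vec_twists // tpermK.
by rewrite mulNr opprK mulrA.
Qed.

Lemma untwist_commute_root_vec k l :
  beta i j * x * beta k l = beta k l * (beta i j * x).
Proof.
rewrite /root_vec -/(beta i j) -sscalerAr -[RHS]sscalerAl; congr (_ *: _).
by rewrite mulrBl mulrBr !untwist_commute.
Qed.

Lemma untwist_sq : x * x = 1 -> beta i j * x * (beta i j * x) = 1.
Proof.
by move=> x2; rewrite mulrA untwist_commute_root_vec -!mulrA x2 mulr1 root_vec_sq.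
Qed.

End Untwist.

(** After collecting the root vectors on the left, the sign from exchanging [x]
    and [y] is compensated by the one from exchanging the root vectors. *)
Lemma untwist_comm i j k l x y : i != j -> k != l ->
    k != i -> k != j -> l != i -> l != j ->
    twists x (tperm i j) -> twists y (tperm k l) -> anticomm A x y ->
  beta i j * x * (beta k l * y) = beta k l * y * (beta i j * x).
Proof.
move=> ij kl ki kj li lj xP yP xy.
rewrite mulrA untwist_commute_root_vec // [RHS]mulrA untwist_commute_root_vec //.
rewrite mulrA -[LHS]mulrA xy [in RHS]mulrA -[RHS]mulrA.
by rewrite (root_vec_anticomm i j k l) // mulrN mulNr.
Qed.

Lemma untwist_braid i j k x y : i != j -> j != k -> i != k ->
    twists x (tperm i j) -> twists y (tperm j k) -> x * y * x = y * x * y ->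
  beta i j * x * (beta j k * y) * (beta i j * x) =
  beta j k * y * (beta i j * x) * (beta j k * y).
Proof.
move=> ij jk ik xP yP xy.
(* Collect the root vectors on the left: they commute with the untwisted
   products standing before them. *)
have sort u v p q p' q' : p != q -> p' != q' ->
  twists u (tperm p q) -> twists v (tperm p' q') ->
  beta p q * u * (beta p' q' * v) * (beta p q * u) =
  beta p q * beta p' q' * beta p q * (u * v * u).
  move=> pq pq' uP vP.
  have vu : beta p' q' * v * (beta p q * u) = beta p q * beta p' q' * (v * u).
    by rewrite mulrA untwist_commute_root_vec // -!mulrA.
  rewrite -[LHS]mulrA vu !mulrA untwist_commute_root_vec // -!mulrA.
  by congr (_ * _); rewrite !mulrA untwist_commute_root_vec // !mulrA.
by rewrite !sort // xy root_vec_braid.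
Qed.

End CliffordFamily.

(** * Palindromic words *)

Lemma downward_ind (P : nat -> Prop) (m : nat) :
    P m -> (forall k, (k < m)%N -> P k.+1 -> P k) ->
  forall k, (k <= m)%N -> P k.
Proof.
move=> Pm PS k /subnKC; move: (m - k)%N => d.
elim: d k => [|d IH] k; first by rewrite addn0 => ->.
rewrite addnS -addSn => h; apply: PS; last exact: IH.
by rewrite -h addSn ltnS leq_addr.
Qed.

Section Palindromes.
Variables (A : pzRingType) (n : nat) (t C : nat -> A).
Hypothesis t_sq : forall i, (i <= n)%N -> t i * t i = 1.
Hypothesis t_far : forall i j, (i.+1 < j)%N -> (j <= n)%N -> anticomm _ (t i) (t j).
Hypothesis t_braid : forall i, (i.+1 < n)%N ->
  t i * t i.+1 * t i = t i.+1 * t i * t i.+1.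
Hypothesis t_last : forall i, i.+1 = n -> (t i * t n) ^+ 4 = -1.
Hypothesis C_last : C n = t n.
Hypothesis C_step : forall i, (i < n)%N -> C i = - (t i * C i.+1 * t i).

Lemma palin_sq i : (i <= n)%N -> C i * C i = 1.
Proof.
move: i; apply: downward_ind => [|i i_n IH]; first by rewrite C_last t_sq.
rewrite C_step // mulrNN !mulrA -(mulrA (t i * C i.+1)) t_sq 1?ltnW // mulr1.
by rewrite -(mulrA (t i)) IH mulr1 t_sq // ltnW.
Qed.

Lemma palin_up i : (i < n)%N -> t i * C i.+1 = - (C i * t i).
Proof.
by move=> i_n; rewrite (C_step i) // mulNr opprK -mulrA t_sq 1?ltnW // mulr1.
Qed.

Lemma palin_down i : (i < n)%N -> t i * C i = - (C i.+1 * t i).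
Proof.
by move=> i_n; rewrite (C_step i) // mulrN !mulrA t_sq 1?ltnW // mul1r.
Qed.

Lemma palin_high i j : (i.+1 < j)%N -> (j <= n)%N -> anticomm _ (t i) (C j).
Proof.
move=> ij jn; move: j jn ij; apply: downward_ind => [|j jn IH] ij.
  by rewrite C_last; exact: t_far.
rewrite (C_step j) //; apply/anticommN/anticomm3; try exact: t_far (ltnW jn).
by apply: IH; exact: ltnW.
Qed.

(** The generator t_i anticommutes with C_k for k < i.  While k < i - 1 the letter
    t_k which surrounds C_(k+1) anticommutes with t_i, so that the claim
    descends from k+1 to k.  The base case k = i - 1 rests on the braid relation
    if i < n, and on (t_(n-1) t_n)^4 = -1 if i = n. *)
Lemma palin_low k i : (k < i)%N -> (i <= n)%N -> anticomm _ (t i) (C k).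
Proof.
case: i => // i; rewrite ltnS => ki i_n; move: k ki.
have jump k : (k < i)%N -> anticomm _ (t i.+1) (C k.+1) -> anticomm _ (t i.+1) (C k).
  move=> ki h; rewrite (C_step k); last exact: leq_trans ki (ltnW i_n).
  by apply/anticommN/anticomm3 => //; apply/anticomm_sym/t_far.
apply: downward_ind => //; move: i_n; rewrite leq_eqVlt => /orP [/eqP in1|i1n].
  (* Here C_i = - x y x, and (x y)^4 = -1 means (x y)^2 = - (y x)^2. *)
  rewrite (C_step i) -?in1 // in1 C_last; apply: anticommN.
  have u4 := t_last _ in1; have tn := t_sq n (leqnn n).
  have ti : t i * t i = 1 by rewrite t_sq // -in1.
  rewrite /anticomm -(mulrA (t i)) !mulrA.
  set x := t i in u4 ti *; set y := t n in u4 tn *.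
  have yx : (y * x) * (x * y) = 1 by rewrite mulrA -(mulrA y) ti mulr1.
  have yx2 : (y * x) ^+ 2 * (x * y) ^+ 2 = 1.
    by rewrite !expr2 mulrA -(mulrA _ (y * x)) yx mulr1.
  rewrite -[LHS]mulrA -expr2 -[x * y * x * y]mulrA -expr2.
  by rewrite -[LHS]mulr1 -[1]opprK -u4 mulrN -[4%N]/(2 + 2)%N exprD mulrA yx2 mul1r.
have br := t_braid _ i1n; have i0n : (i < n)%N by exact: ltnW.
have hi := palin_high i i.+2 (ltnSn _) i1n.
(* Here C_i = x y z y x where z = C_(i+2) anticommutes with x. *)
rewrite (C_step i) // (C_step i.+1) //; move: hi.
set x := t i in br *; set y := t i.+1 in br *; set z := C i.+2 => hi.
rewrite /anticomm !(mulrN, mulNr, opprK) !mulrA.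
rewrite -br -(mulrA (x * y) x) hi mulrN !mulNr; congr (- _).
by rewrite -!mulrA; do 3 congr (_ * _); rewrite !mulrA br.
Qed.

(** Downward induction on j: C_j = - t_j C_(j+1) t_j, and C_i anticommutes with
    t_j because i < j ([palin_low]). *)
Lemma palin_anticomm i j : (i < j)%N -> (j <= n)%N -> anticomm _ (C i) (C j).
Proof.
move=> ij jn; move: j jn ij; apply: downward_ind => [|j jn IH] ij.
  by rewrite C_last; apply/anticomm_sym/palin_low.
rewrite (C_step j) //; apply/anticommN/anticomm3.
- by apply/anticomm_sym/palin_low => //; exact: ltnW.
- by apply: IH; exact: ltnW.
- by apply/anticomm_sym/palin_low => //; exact: ltnW.
Qed.

End Palindromes.

(** * The Clifford algebra inside the spin Weyl group algebra *)

Section CliffordRelations.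
Variables (K : comNzRingType) (n : nat).

Lemma cgen_sq (i : 'I_n) : cgen i * cgen i = 1 :> cliff K n.
Proof. by rewrite -expr2 -spiX -spi1; apply: squot_rel; exact: CliffSq. Qed.

Lemma cgen_anticomm (i j : 'I_n) : i != j ->
  anticomm (cliff K n) (cgen i) (cgen j).
Proof.
move=> ij; rewrite /anticomm -!spiM -linearN; apply: squot_rel; exact: CliffAnti.
Qed.

End CliffordRelations.

Lemma filter_iota_range i m k : (i <= m <= k)%N ->
  [seq j <- iota 0 k | (i <= j < m)%N] = iota i (m - i).
Proof.
case/andP=> im mk; rewrite -(subnKC (leq_trans im mk)) iotaD filter_cat.
rewrite (_ : (k - i = (m - i) + (k - m))%N) ?iotaD; last by rewrite addnC addnBA ?subnK.
rewrite filter_cat add0n subnKC //.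
rewrite [X in X ++ _](eq_in_filter (a2 := pred0)) ?filter_pred0 => [|j]; last first.
  by rewrite mem_iota /= add0n ltnNge => /negPf ->.
rewrite [X in _ ++ X ++ _](eq_in_filter (a2 := predT)) ?filter_predT => [|j];
  last first.
  by rewrite mem_iota subnKC.
rewrite [X in _ ++ _ ++ X](eq_in_filter (a2 := pred0)) ?filter_pred0 ?cats0 // => j.
by rewrite mem_iota => /andP [mj _]; rewrite [(j < m)%N]ltnNge mj andbF.
Qed.

Section SpinBRelations.
Variables (K : comNzRingType) (n : nat).
Local Notation B := (spinB K n.+1).

(** Natural number indices, the last generator having index n, make i+1
    available without a proof that it is in range. *)
Definition spin_t (i : nat) : B := tgen (inord i).
Definition spin_palin (i : nat) : B := tpalin (inord i).
Local Notation t := spin_t.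
Local Notation C := spin_palin.

Lemma spinB_sq i : t i * t i = 1.
Proof. by rewrite -expr2 -spiX -spi1; apply: squot_rel; exact: SpinBSq. Qed.

Lemma spinB_far i j : (i.+1 < j)%N -> (j <= n)%N -> anticomm B (t i) (t j).
Proof.
move=> ij jn; have i_n : (i <= n)%N by rewrite ltnW // ltnW // (leq_trans ij).
apply: anticomm_of_sq; rewrite ?spinB_sq //.
rewrite -spiM -spiX -spi1 -linearN; apply: squot_rel; apply: SpinBFar.
by rewrite !inordK // ij.
Qed.

Lemma spinB_braid i : (i.+1 < n)%N ->
  t i * t i.+1 * t i = t i.+1 * t i * t i.+1.
Proof.
move=> i1n; rewrite -!spiM; apply: squot_rel; apply: SpinBBraid.
  by rewrite !inordK // ltnW // ltnW.
by rewrite inordK // ltnW.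
Qed.

Lemma spinB_last i : i.+1 = n -> (t i * t n) ^+ 4 = -1.
Proof.
move=> i1n; rewrite -spiM -spiX -spi1 -linearN; apply: squot_rel; apply: SpinBLast.
  by rewrite !inordK // -?i1n ltnW.
by rewrite inordK.
Qed.

Lemma spin_palinE i : (i <= n)%N -> C i = (-1) ^+ (n - i) *:
  (\prod_(j <- iota i (n.+1 - i)) t j * \prod_(j <- rev (iota i (n - i))) t j).
Proof.
move=> i_n.
have big_val (s : seq 'I_n.+1) : \prod_(j <- s) tgen j = \prod_(k <- map val s) t k.
  by rewrite big_map; apply: eq_bigr => j _; rewrite /spin_t inord_val.
have range m : (i <= m <= n.+1)%N ->
    map val [seq j : 'I_n.+1 <- enum 'I_n.+1 | (i <= j < m)%N] = iota i (m - i).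
  by move=> h; rewrite -(filter_iota_range _ _ _ h) -val_enum_ord filter_map.
rewrite /spin_palin /tpalin (inordK (i_n : (i < n.+1)%N)) subSS.
congr (_ *: _); congr (_ * _).
  rewrite big_val -range ?leqnn ?(leqW i_n) //; congr (\prod_(j <- map _ _) _).
  by apply: eq_filter => j /=; rewrite ltn_ord andbT.
by rewrite big_val map_rev -range // i_n leqnSn.
Qed.

Lemma spin_palin_last : C n = t n.
Proof.
by rewrite spin_palinE // subnn subSnn /= big_seq1 big_nil scale1r mulr1.
Qed.

(** Each step of the recursion removes the outer pair of letters and one sign. *)
Lemma spin_palin_step i : (i < n)%N -> C i = - (t i * C i.+1 * t i).
Proof.
move=> i_n; rewrite (spin_palinE i (ltnW i_n)) (spin_palinE i.+1 i_n).
rewrite subSS (subSn (ltnW i_n)) -(subnSK i_n).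
set d := (n - i.+1)%N.
rewrite -[iota i d.+2]/(i :: iota i.+1 d.+1) -[iota i d.+1]/(i :: iota i.+1 d).
rewrite rev_cons -cats1 big_cat big_seq1 big_cons.
by rewrite -sscalerAr -sscalerAl exprS mulN1r scaleNr /= !mulrA.
Qed.

Lemma spin_palin_homog i : (i <= n)%N -> homog true (C i).
Proof.
move: i; apply: downward_ind => [|i i_n IH].
  by rewrite spin_palin_last; exact: homog_tgen.
rewrite spin_palin_step //; apply: homogN.
have ti := homog_tgen K (inord i : 'I_n.+1).
exact: (homogM (homogM ti IH) ti).
Qed.

Lemma spin_palin_sq i : (i <= n)%N -> C i * C i = 1.
Proof.
apply: palin_sq; first by move=> j _; exact: spinB_sq.
  exact: spin_palin_last.
exact: spin_palin_step.
Qed.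

(** The conditional is the action of the transposition (i i+1) on k. *)
Lemma spin_t_palin i k : (i < n)%N -> (k <= n)%N ->
  t i * C k = - (C (if k == i then i.+1 else if k == i.+1 then i else k) * t i).
Proof.
have sqP j : (j <= n)%N -> t j * t j = 1 by move=> _; exact: spinB_sq.
have farP := spinB_far; have stepP := spin_palin_step; have lastP := spin_palin_last.
move=> i_n k_n; case: (ltngtP k i) => [ki|ik|->].
- rewrite (ltn_eqF (ltnW ki : (k < i.+1)%N)).
  apply: (palin_low B n t C) => //; last exact: ltnW.
    exact: spinB_braid.
  exact: spinB_last.
- case: eqP => [->|/eqP ik1]; first exact: (palin_up B n t C).
  by apply: (palin_high B n t C) => //; rewrite ltn_neqAle eq_sym ik1.
exact: (palin_down B n t C).
Qed.

Lemma spin_palin_anticomm i j : (i < j)%N -> (j <= n)%N -> anticomm B (C i) (C j).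
Proof.
apply: (palin_anticomm B n t C).
- by move=> k _; exact: spinB_sq.
- exact: spinB_far.
- exact: spinB_braid.
- exact: spinB_last.
- exact: spin_palin_last.
exact: spin_palin_step.
Qed.

Section InvertibleTwo.
Variables (a : K).
Hypothesis a_half : a * a + a * a = 1.

Lemma tpalin_nat (i : 'I_n.+1) : tpalin i = C i.
Proof. by rewrite /spin_palin inord_val. Qed.

Lemma tpalin_sq (i : 'I_n.+1) : tpalin i * tpalin i = 1 :> B.
Proof. by rewrite tpalin_nat spin_palin_sq // -ltnS. Qed.

Lemma tpalin_anticomm (i j : 'I_n.+1) : i != j ->
  anticomm B (tpalin i) (tpalin j).
Proof.
rewrite !tpalin_nat -val_eqE neq_ltn => /orP [ij|ji].
  by apply: spin_palin_anticomm; rewrite // -ltnS.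
by apply: anticomm_sym; apply: spin_palin_anticomm; rewrite // -ltnS.
Qed.

Lemma spin_t_twists i : (i < n)%N -> twists K B _ tpalin (t i) (adjacent n i).
Proof.
move=> i_n k; have kn : (k <= n)%N by rewrite -ltnS.
have iE : (inord i : 'I_n.+1) = i :> nat by rewrite inordK // ltnW.
have i1E : (inord i.+1 : 'I_n.+1) = i.+1 :> nat by rewrite inordK.
rewrite (tpalin_nat k) (spin_t_palin _ _ i_n kn) (tpalin_nat (adjacent n i k)).
suff -> : (adjacent n i k : nat) =
    if k == i :> nat then i.+1 else if k == i.+1 :> nat then i else k by [].
rewrite /adjacent; case: tpermP => [->|->|/eqP ki /eqP kj].
- by rewrite iE i1E eqxx.
- by rewrite iE i1E (gtn_eqF (ltnSn i)) eqxx.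
by move: ki kj; rewrite -!val_eqE /= iE i1E => /negPf -> /negPf ->.
Qed.

(** The image of the i-th adjacent transposition under the inverse isomorphism. *)
Definition spin_s i : B :=
  root_vec K B _ a tpalin (inord i) (inord i.+1) * t i.

Lemma spin_s_coxeter : coxeter_typeA n B 1 *%R spin_s.
Proof.
have neq i j : (i < j <= n)%N -> (inord i : 'I_n.+1) != inord j by exact: inord_neq.
have neqS i : (i < n)%N -> (inord i : 'I_n.+1) != inord i.+1.
  by move=> i_n; apply: neq; rewrite ltnSn.
split=> [i i_n|i i1n|i j ij jn].
- exact: (untwist_sq K B _ a tpalin a_half tpalin_sq tpalin_anticomm _ _ _
    (neqS i i_n) (spin_t_twists i i_n) (spinB_sq i)).
- have i_n : (i < n)%N by exact: ltnW.
  have ii2 : (inord i : 'I_n.+1) != inord i.+2 by apply: neq; rewrite ltnS leqnSn.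
  exact: (untwist_braid K B _ a tpalin a_half tpalin_sq tpalin_anticomm _ _ _ _ _
    (neqS i i_n) (neqS _ i1n) ii2 (spin_t_twists i i_n) (spin_t_twists _ i1n)
    (spinB_braid i i1n)).
have lt2 k l : (k <= i.+1)%N -> (j <= l <= j.+1)%N -> (inord l : 'I_n.+1) != inord k.
  move=> ki /andP [jl lj]; rewrite eq_sym; apply: neq.
  by rewrite (leq_trans lj jn) andbT (leq_trans _ jl) // (leq_trans _ ij).
have i_n : (i < n)%N by rewrite (leq_trans (ltnW ij)) // ltnW.
have jj : (j <= j <= j.+1)%N by rewrite leqnn leqnSn.
have jj1 : (j <= j.+1 <= j.+1)%N by rewrite leqnn leqnSn.
exact: (untwist_comm K B _ a tpalin tpalin_sq tpalin_anticomm _ _ _ _ _ _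
  (neqS i i_n) (neqS j jn) (lt2 _ _ (leqnSn i) jj) (lt2 _ _ (leqnn _) jj)
  (lt2 _ _ (leqnSn i) jj1) (lt2 _ _ (leqnn _) jj1)
  (spin_t_twists i i_n) (spin_t_twists j jn) (spinB_far i j ij (ltnW jn))).
Qed.

Lemma spin_s_homog i : homog false (spin_s i).
Proof.
rewrite -[false]/(true (+) true); apply: homogM; last exact: homog_tgen.
apply: homogZ; apply: homogB; rewrite tpalin_nat; apply: spin_palin_homog;
  by rewrite -ltnS.
Qed.

Lemma spin_s_commute i k : (i < n)%N ->
  spin_s i * tpalin k = tpalin k * spin_s i.
Proof.
move=> i_n; have neq : (inord i : 'I_n.+1) != inord i.+1.
  by apply: inord_neq; rewrite ltnSn.
exact: (untwist_commute K B _ a tpalin tpalin_sq tpalin_anticomm _ _ _ neq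
  (spin_t_twists i i_n)).
Qed.

End InvertibleTwo.
End SpinBRelations.

(** * The spin relations in the tensor product *)

Section TensorGenerators.
Variables (K : comNzRingType) (n : nat) (a : K).
Hypothesis a_half : a * a + a * a = 1.
Variables (A : superAlgType K) (c : 'I_n.+1 -> A).
Hypothesis c_sq : forall i, c i * c i = 1.
Hypothesis c_anti : forall i j, i != j -> anticomm A (c i) (c j).
Hypothesis c_odd : forall i, homog true (c i).
Local Notation CS := (grpalg K 'S_n.+1).
Local Notation T := (stens A CS).

Definition croot i : A := root_vec K A _ a c (inord i) (inord i.+1).

Let neqS i : (i < n)%N -> (inord i : 'I_n.+1) != inord i.+1.
Proof. by move=> i_n; apply: inord_neq; rewrite ltnSn. Qed.

Definition phi_gen (i : nat) : T :=
  if (i < n)%N then croot i \ot gelt (adjacent n i) else c (inord i) \ot 1.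

Lemma croot_homog i : homog true (croot i).
Proof. by apply: homogZ; apply: homogB; apply: c_odd. Qed.

Lemma croot_sq i : (i < n)%N -> croot i * croot i = 1.
Proof.
move=> i_n.
exact: (root_vec_sq K A _ a c a_half c_sq c_anti _ _ (neqS i i_n)).
Qed.

Lemma croot_conj i k : (i < n)%N ->
  croot i * c k = - (c (adjacent n i k) * croot i).
Proof.
move=> i_n.
exact: (root_vec_twists K A _ a c c_sq c_anti _ _ (neqS i i_n)).
Qed.

Lemma croot_braid i : (i.+1 < n)%N ->
  croot i * croot i.+1 * croot i = croot i.+1 * croot i * croot i.+1.
Proof.
move=> i1n; have i_n : (i < n)%N by exact: ltnW.
have ii2 : (inord i : 'I_n.+1) != inord i.+2 by apply: inord_neq; rewrite ltnS leqnSn.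
exact: (root_vec_braid K A _ a c a_half c_sq c_anti
  _ _ _ (neqS i i_n) (neqS _ i1n) ii2).
Qed.

Lemma croot_far i j : (i.+1 < j)%N -> (j < n)%N -> anticomm A (croot i) (croot j).
Proof.
move=> ij jn; have i_n : (i < n)%N by rewrite (leq_trans (ltnW ij)) // ltnW.
have neq k l : (k < l <= n)%N -> (inord l : 'I_n.+1) != inord k.
  by rewrite eq_sym; exact: inord_neq.
have lt2 k l : (k <= i.+1)%N -> (j <= l <= j.+1)%N -> (inord l : 'I_n.+1) != inord k.
  move=> ki /andP [jl lj]; apply: neq.
  by rewrite (leq_trans lj jn) andbT (leq_trans _ jl) // (leq_trans _ ij).
have jj : (j <= j <= j.+1)%N by rewrite leqnn leqnSn.
have jj1 : (j <= j.+1 <= j.+1)%N by rewrite leqnn leqnSn.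
exact: (root_vec_anticomm K A _ a c c_sq c_anti
  _ _ _ _ (neqS i i_n) (lt2 _ _ (leqnSn i) jj) (lt2 _ _ (leqnn _) jj)
  (lt2 _ _ (leqnSn i) jj1) (lt2 _ _ (leqnn _) jj1)).
Qed.

Lemma croot_last i : i.+1 = n -> (croot i * c (inord n)) ^+ 4 = -1.
Proof.
move=> i1n; have i_n : (i < n)%N by rewrite -i1n.
have -> : inord n = inord i.+1 :> 'I_n.+1 by rewrite i1n.
exact: (root_vec_last K A _ a c a_half c_sq c_anti _ _ (neqS i i_n)).
Qed.

Lemma phi_gen_homog i : homog true (phi_gen i).
Proof.
rewrite /phi_gen; case: ifP => _; apply: tensor_homog.
  exact: croot_homog.
exact: c_odd.
Qed.

Lemma adjacent_sq i : (gelt (adjacent n i) : CS) * gelt (adjacent n i) = 1.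
Proof. by rewrite geltM tperm2. Qed.

Lemma phi_gen_lt i : (i < n)%N -> phi_gen i = croot i \ot gelt (adjacent n i).
Proof. by rewrite /phi_gen => ->. Qed.

Lemma phi_gen_n : phi_gen n = c (inord n) \ot 1.
Proof. by rewrite /phi_gen ltnn. Qed.

Lemma phi_gen_sq i : phi_gen i * phi_gen i = 1.
Proof.
have [i_n|n_i] := ltnP i n.
  by rewrite phi_gen_lt // tensorM croot_sq // adjacent_sq stens1.
by rewrite /phi_gen ltnNge n_i tensorM c_sq mulr1 stens1.
Qed.

Lemma phi_gen_braid i : (i.+1 < n)%N ->
  phi_gen i * phi_gen i.+1 * phi_gen i = phi_gen i.+1 * phi_gen i * phi_gen i.+1.
Proof.
move=> i1n; rewrite (phi_gen_lt i (ltnW i1n)) (phi_gen_lt _ i1n) !tensorM !geltM.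
by have [_ br _] := adjacent_coxeter n; rewrite (br i i1n) (croot_braid i i1n).
Qed.

Lemma phi_gen_far i j : (i.+1 < j)%N -> (j <= n)%N ->
  anticomm T (phi_gen i) (phi_gen j).
Proof.
move=> ij jn; have i1n : (i.+1 < n)%N by exact: leq_trans jn.
have i_n : (i < n)%N by exact: ltnW.
rewrite /anticomm (phi_gen_lt i i_n).
move: jn; rewrite leq_eqVlt => /orP [/eqP ->|j_n].
  rewrite phi_gen_n !tensorM mul1r mulr1 (croot_conj i _ i_n) tensorN tpermD //.
    by apply: inord_neq; rewrite i_n leqnn.
  by apply: inord_neq; rewrite i1n leqnn.
rewrite (phi_gen_lt j j_n) !tensorM !geltM (croot_far i j ij j_n) tensorN.
by have [_ _ far] := adjacent_coxeter n; rewrite (far i j ij j_n).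
Qed.

Lemma phi_gen_last i : i.+1 = n -> (phi_gen i * phi_gen n) ^+ 4 = -1.
Proof.
move=> i1n; have i_n : (i < n)%N by rewrite -i1n.
rewrite (phi_gen_lt i i_n) phi_gen_n tensorM mulr1 tensorX (croot_last i i1n).
have s4 : (gelt (adjacent n i) : CS) ^+ 4 = 1.
  by rewrite -[4%N]/(2 * 2)%N exprM [X in X ^+ 2]expr2 adjacent_sq expr1n.
by rewrite s4 tensorN stens1.
Qed.

End TensorGenerators.

(** * Presentations of both sides and the isomorphism *)

Section UniversalProperties.
Variables (K : comNzRingType) (n : nat).
Local Notation B := (spinB K n.+1).
Local Notation Cl := (cliff K n.+1).
Local Notation CS := (grpalg K 'S_n.+1).
Local Notation T := (stens Cl CS).

Lemma spinB_lift (D : superAlgType K) (g : nat -> D) :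
    (forall i, homog true (g i)) ->
    (forall i, g i * g i = 1) ->
    (forall i, (i.+1 < n)%N -> g i * g i.+1 * g i = g i.+1 * g i * g i.+1) ->
    (forall i j, (i.+1 < j)%N -> (j <= n)%N -> anticomm D (g i) (g j)) ->
    (forall i, i.+1 = n -> (g i * g n) ^+ 4 = -1) ->
  exists2 phi : B -> D, superalg_morphism phi & forall i, phi (tgen i) = g i.
Proof.
move=> g_odd g_sq g_braid g_far g_last.
pose h (i : 'I_n.+1) : D := g i.
have le (i : 'I_n.+1) : (i <= n)%N by rewrite -ltnS.
have h_rel (f : freealg K 'I_n.+1 -> D) : superalg_morphism f ->
    (forall i, f (fgen i) = h i) -> forall l r, spinB_rel l r -> f l = f r.
  move=> fP fh l r; case=> [i|i j ji j_n|i j ij|i j ji j_n].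
  - by rewrite (smorX fP) (smor1 fP) fh expr2 g_sq.
  - have fM x y z : f (x * y * z) = f x * f y * f z by rewrite (smorM fP) (smorM fP).
    apply: etrans (fM (fgen i) (fgen j) (fgen i)) _.
    apply: etrans _ (esym (fM (fgen j) (fgen i) (fgen j))).
    by rewrite !fh /h ji g_braid // -ji -ltnS.
  - rewrite (smorX fP) (smorM fP) (smorN fP) (smor1 fP) !fh.
    apply: sq_of_anticomm; rewrite ?g_sq //; case/orP: ij => ij.
      exact: g_far.
    by apply/anticomm_sym/g_far.
  rewrite (smorX fP) (smorM fP) (smorN fP) (smor1 fP) !fh /h.
  by have [jn] := j_n; rewrite jn g_last // -ji.
exact: (presented_lift K _ (HRelations (@spinB_relP K n.+1)) D h
  (fun i => g_odd i) h_rel).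
Qed.

Lemma cliff_lift (D : superAlgType K) (c : 'I_n.+1 -> D) :
    (forall i, homog true (c i)) ->
    (forall i, c i * c i = 1) ->
    (forall i j, i != j -> anticomm D (c i) (c j)) ->
  exists2 f : Cl -> D, superalg_morphism f & forall i, f (cgen i) = c i.
Proof.
move=> c_odd c_sq c_anti.
have c_rel (f : freealg K 'I_n.+1 -> D) : superalg_morphism f ->
    (forall i, f (fgen i) = c i) -> forall l r, cliff_rel l r -> f l = f r.
  move=> fP fh l r; case=> [i|i j ij].
    by rewrite (smorX fP) (smor1 fP) fh expr2 c_sq.
  rewrite (smorN fP); apply: etrans (smorM fP (fgen i) (fgen j)) _.
    rewrite !fh (c_anti _ _ ij); congr (- _).
    by rewrite -!fh; apply: esym; exact: (smorM fP (fgen j) (fgen i)).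
exact: (presented_lift K _ (HRelations (@cliff_relP K n.+1)) D c c_odd c_rel).
Qed.

(** Commutation of s_i with the c_k is the supercommutation required of the two
    factors of a tensor product, because the second factor is even; it extends
    from generators to all elements by induction on both factors. *)
Lemma cliff_sym_lift (D : superAlgType K) (c : 'I_n.+1 -> D) (s : nat -> D) :
    (forall i, homog true (c i)) ->
    (forall i, c i * c i = 1) ->
    (forall i j, i != j -> anticomm D (c i) (c j)) ->
    (forall i, homog false (s i)) ->
    coxeter_typeA n D 1 *%R s ->
    (forall i k, (i < n)%N -> s i * c k = c k * s i) ->
  exists2 psi : T -> D, superalg_morphism psi &
    (forall i, psi (cgen i \ot 1) = c i) /\
    (forall i, (i < n)%N -> psi (1 \ot gelt (adjacent n i)) = s i).
Proof.
move=> c_odd c_sq c_anti s_even s_cox sc.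
have [f fP fE] := cliff_lift D c c_odd c_sq c_anti.
have [h [h1 hM hs]] := symmetric_group_lift n D 1 *%R s s_cox.
have h_even p : homog false (h p).
  elim/(adjacent_ind n): p => [|i p i_n hp]; first by rewrite h1; exact: homog1.
  by rewrite hM hs //; exact: (homogM (s_even i) hp).
have [g gP gE] := grpalg_lift K _ D h h1 hM h_even.
have hf p x : h p * f x = f x * h p.
  elim/(adjacent_ind n): p => [|i p i_n hp]; first by rewrite h1 mul1r mulr1.
  have sf y : s i * f y = f y * s i.
    elim/presented_ind: y => [|y z IH IH'|k y IH|j y IH].
    - by rewrite (smor1 fP) mul1r mulr1.
    - by rewrite (smorD fP) mulrDr mulrDl IH IH'.
    - by rewrite (smorZ fP) -sscalerAr -sscalerAl IH.
    by rewrite (smorM fP) fE mulrA sc // -mulrA IH mulrA.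
  by rewrite hM hs // -mulrA hp !mulrA sf.
have gf y x : g y * f x = f x * g y.
  rewrite (grpalg_decomp K _ y) (linear_fun_sum (smor_linear gP)) mulr_suml mulr_sumr.
  apply: eq_bigr => p _.
  by rewrite (smorZ gP) gE -sscalerAl -sscalerAr hf.
have [//|psi psiP psiE] := stens_lift K Cl CS D f g fP gP _.
  (* An odd element of the group algebra is zero. *)
  case=> q y x hy hx /=; last by rewrite scale1r gf.
  by rewrite [y]hy (linear_fun0 (smor_linear gP)) mul0r mulr0 scaler0.
exists psi => //; split=> [i|i i_n]; rewrite psiE.
  by rewrite fE (smor1 gP) mulr1.
by rewrite (smor1 fP) mul1r gE hs.
Qed.

Lemma cliff_sym_eq (D : superAlgType K) (f g : T -> D) :
    superalg_morphism f -> superalg_morphism g ->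
    (forall i, f (cgen i \ot 1) = g (cgen i \ot 1)) ->
    (forall i, (i < n)%N ->
       f (1 \ot gelt (adjacent n i)) = g (1 \ot gelt (adjacent n i))) ->
  f =1 g.
Proof.
move=> fP gP fgc fgs.
have fgl (x : Cl) : f (x \ot 1) = g (x \ot 1).
  elim/presented_ind: x => [|x y IH IH'|k x IH|i x IH].
  - by rewrite stens1 (smor1 fP) (smor1 gP).
  - by rewrite tensorDl (smorD fP) (smorD gP) IH IH'.
  - by rewrite /stensor ptensZl (smorZ fP) (smorZ gP); congr (_ *: _).
  have -> : (spi (HRelations (@cliff_relP K n.+1)) (fgen i) * x : Cl) \ot (1 : CS) =
      (cgen i \ot 1) * (x \ot 1) by rewrite tensorM mulr1.
  by rewrite (smorM fP) (smorM gP) IH fgc.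
have fgr p : f (1 \ot gelt p) = g (1 \ot gelt p).
  elim/(adjacent_ind n): p => [|i p i_n IH].
    by rewrite gelt1 stens1 (smor1 fP) (smor1 gP).
  have -> : (1 : Cl) \ot (gelt (adjacent n i * p)%g : CS) =
      (1 \ot gelt (adjacent n i)) * (1 \ot gelt p) by rewrite tensorM mulr1 geltM.
  by rewrite (smorM fP (1 \ot _)) (smorM gP (1 \ot _)) IH fgs.
elim/tens_ind => [x y IH IH'|x y].
  by rewrite (smorD fP x y) (smorD gP x y) IH IH'.
rewrite (grpalg_decomp K _ y) -/(stensor x _).
have sumE : x \ot (\sum_p y p *: gelt p : CS) =
    \sum_p (y p : K) *: ((x \ot 1) * (1 \ot gelt p)).
  rewrite [LHS](linear_sum (ptens x)); apply: eq_bigr => p _.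
  by rewrite tensorM mulr1 mul1r; exact: (linear_funZ (ptensR x)).
rewrite sumE (linear_fun_sum (smor_linear fP)) (linear_fun_sum (smor_linear gP)).
apply: eq_bigr => p _.
by rewrite (smorZ fP) (smorZ gP) (smorM fP) (smorM gP) fgl fgr.
Qed.

End UniversalProperties.

Section Isomorphism.
Variables (K : comNzRingType) (n : nat) (a : K).
Hypothesis a_half : a * a + a * a = 1.
Local Notation B := (spinB K n.+1).
Local Notation Cl := (cliff K n.+1).
Local Notation CS := (grpalg K 'S_n.+1).
Local Notation T := (stens Cl CS).
Local Notation beta := (croot K n a Cl cgen).

Lemma morphism_croot_tensor1 (D : superAlgType K) (f : T -> D) i :
    superalg_morphism f ->
  f (beta i \ot 1) = a *: (f (cgen (inord i) \ot 1) - f (cgen (inord i.+1) \ot 1)).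
Proof.
move=> fP; rewrite -(smorB fP) -tensorN -tensorDl -(smorZ fP); congr (f _).
exact: ptensZl.
Qed.

Lemma spinB_cliff_sym_iso :
  exists (phi : B -> T) (psi : T -> B),
  superalg_isomorphism phi psi /\
  [/\ forall i, (i < n)%N -> phi (spin_t K n i) = beta i \ot gelt (adjacent n i),
      phi (spin_t K n n) = cgen (inord n) \ot 1,
      forall i : 'I_n.+1, psi (cgen i \ot 1) = tpalin i
    & forall i, (i < n)%N -> psi (1 \ot gelt (adjacent n i)) = spin_s K n a i].
Proof.
have [phi phiP phiE] := spinB_lift K n T (phi_gen K n a Cl cgen)
  (phi_gen_homog K n a Cl cgen (@homog_cgen K _))
  (phi_gen_sq K n a a_half Cl cgen (@cgen_sq K _) (@cgen_anticomm K _))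
  (phi_gen_braid K n a a_half Cl cgen (@cgen_sq K _) (@cgen_anticomm K _))
  (phi_gen_far K n a Cl cgen (@cgen_sq K _) (@cgen_anticomm K _))
  (phi_gen_last K n a a_half Cl cgen (@cgen_sq K _) (@cgen_anticomm K _)).
have tpalin_odd (i : 'I_n.+1) : homog true (tpalin i : B).
  by rewrite tpalin_nat; apply: spin_palin_homog; rewrite -ltnS.
have [psi psiP [psi_c psi_s]] := cliff_sym_lift K n B tpalin (spin_s K n a)
  tpalin_odd (@tpalin_sq K n) (@tpalin_anticomm K n) (@spin_s_homog K n a)
  (@spin_s_coxeter K n a a_half) (@spin_s_commute K n a).
have phi_t i : (i <= n)%N -> phi (spin_t K n i) = phi_gen K n a Cl cgen i.
  by move=> i_n; rewrite /spin_t phiE inordK.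
have phi_t_lt i : (i < n)%N -> phi (spin_t K n i) = beta i \ot gelt (adjacent n i).
  by move=> i_n; rewrite phi_t ?phi_gen_lt // ltnW.
have phi_t_n : phi (spin_t K n n) = cgen (inord n) \ot 1 by rewrite phi_t ?phi_gen_n.
(* beta_i c_(i+1) beta_i = - c_i, while the two copies of s_i cancel. *)
have phi_C i : (i <= n)%N -> phi (spin_palin K n i) = cgen (inord i) \ot 1.
  move: i; apply: downward_ind => [|i i_n IH]; first by rewrite spin_palin_last.
  rewrite spin_palin_step // (smorN phiP) (smorM phiP) (smorM phiP (spin_t K n i)).
  rewrite IH phi_t_lt // !tensorM mulr1 adjacent_sq -tensorN; congr (_ \ot _).
  rewrite (croot_conj K n a Cl cgen (@cgen_sq K _) (@cgen_anticomm K _)) // tpermR.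
  rewrite mulNr opprK -mulrA.
  rewrite (croot_sq K n a a_half Cl cgen (@cgen_sq K _) (@cgen_anticomm K _)) //.
  by rewrite mulr1.
have psi_beta i : psi (beta i \ot 1) =
    root_vec K B _ a tpalin (inord i) (inord i.+1).
  rewrite (morphism_croot_tensor1 B psi i psiP).
  by rewrite (psi_c (inord i)) (psi_c (inord i.+1)).
have phi_s i : (i < n)%N -> phi (spin_s K n a i) = 1 \ot gelt (adjacent n i).
  move=> i_n; rewrite /spin_s (smorM phiP) phi_t_lt //.
  have -> : phi (root_vec K B _ a tpalin (inord i) (inord i.+1)) = beta i \ot 1.
    rewrite (morphism_croot_tensor1 _ id) // (smorZ phiP) (smorB phiP).
    by rewrite -!phi_C // ltnW.
  rewrite tensorM mul1r.
  by rewrite (croot_sq K n a a_half Cl cgen (@cgen_sq K _) (@cgen_anticomm K _)).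
exists phi, psi; split; last by split.
split=> //.
- apply: (presented_eq K _ _ B (psi \o phi) id
    (smor_comp _ _ _ _ _ _ phiP psiP) (smor_id _ _)) => i.
  rewrite /= -/(tgen i) -(inord_val i) -/(spin_t K n i).
  have := ltn_ord i; rewrite ltnS leq_eqVlt => /orP [/eqP ->|i_n].
    by rewrite phi_t_n psi_c -spin_palin_last.
  rewrite phi_t_lt // -[beta i]mulr1 -[gelt _]mul1r -tensorM.
  rewrite (smorM psiP) psi_beta psi_s // /spin_s mulrA.
  rewrite (root_vec_sq K B _ a tpalin a_half (@tpalin_sq K n)
    (@tpalin_anticomm K n)) ?mul1r //.
  by apply: inord_neq; rewrite ltnSn.
apply: (cliff_sym_eq K n T (phi \o psi) id
  (smor_comp _ _ _ _ _ _ psiP phiP) (smor_id _ _)) => [i|i i_n] /=.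
  by rewrite psi_c tpalin_nat phi_C ?inord_val // -ltnS.
by rewrite psi_s // phi_s.
Qed.

End Isomorphism.

Theorem theorem4p1 (R : realType) (n : nat) (n_gt0 : (0 < n)%N) :
  exists (phi : spinB R[i] n -> stens (cliff R[i] n) (grpalg R[i] 'S_n))
         (psi : stens (cliff R[i] n) (grpalg R[i] 'S_n) -> spinB R[i] n),
  superalg_isomorphism phi psi /\
  [/\ forall i j : 'I_n, j = i.+1 :> nat ->
        phi (tgen i) = beta R i j \ot gelt (tperm i j),
      forall i : 'I_n, i.+1 = n -> phi (tgen i) = cgen i \ot 1,
      forall i : 'I_n, psi (cgen i \ot 1) = tpalin i
    & forall i j : 'I_n, j = i.+1 :> nat ->
        psi (1 \ot gelt (tperm i j)) = tbeta R i j * tgen i].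
Proof.
case: n n_gt0 => // n _.
pose a : R[i] := (Num.sqrt 2)%:C%C^-1.
have a_half : a * a + a * a = 1.
  rewrite -mulr2n -[LHS]mulr_natr /a -invfM -rmorphM /= -expr2.
  rewrite Num.Theory.sqr_sqrtr ?Num.Theory.ler0n //.
  by rewrite rmorph_nat mulVf // Num.Theory.pnatr_eq0.
have [phi [psi [iso [phi_t phi_n psi_c psi_s]]]] :=
  spinB_cliff_sym_iso R[i] n a a_half.
have adj (i j : 'I_n.+1) : j = i.+1 :> nat ->
    [/\ (i < n)%N, i = inord i & j = inord i.+1].
  move=> ji; have := ltn_ord j; rewrite {1}ji ltnS => i_n.
  by split=> //; rewrite -?ji inord_val.
exists phi, psi; split=> //.
split=> // [i j /adj [i_n iE jE]|i [i_n]|i j /adj [i_n iE jE]].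
- have := phi_t i i_n; rewrite /spin_t /croot /adjacent -iE -jE; exact.
- have -> : i = inord n by apply/val_inj; rewrite /= inordK.
  exact: phi_n.
have := psi_s i i_n; rewrite /spin_s /spin_t /adjacent -iE -jE; exact.
Qed.
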